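(* Let $\{J_{i,j}\}_{1\le i,j\le N}$ be independent identically distributed strictly subgaussian real random variables with $\mathbb{E}[J_{1,1}]=0$ and $\operatorname{Var}(J_{1,1})=1$. For $\eta\in\{0,1\}^N$ let $H(J,\eta)=\frac{1}{\sqrt N}\sum_{1\le i,j\le N}J_{i,j}\eta_i\eta_j$, and for $m\in\mathbb{R}$ let $\nu^{-}(m)=|\{\eta\in\{0,1\}^N : H(J,\eta)\le -mN\}|$ and $\nu^{+}(m)=|\{\eta\in\{0,1\}^N : H(J,\eta)\ge mN\}|$. Let $I(x)=-x\log x-(1-x)\log(1-x)$ for $x\in(0,1)$. Let $m^\star\approx 0.562$ be the extremal (threshold) value of $m>0$ beyond which the function $$\alpha\mapsto I(\alpha)-\frac{m^2}{2\alpha^2(1-\alpha^2)},\qquad \alpha\in(0,1),$$ for fixed $m$, has no zeros (this extremal value is obtained for $\alpha=\alpha^\star\approx 0.644$). Then, for some constant $C>0$ and all sufficiently large $N$, $$P\big(\nu^{-}(m^\star)>0\big)\le e^{-CN}\quad\text{and}\quad P\big(\nu^{+}(m^\star)>0\big)\le e^{-CN}.$$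
   Context: A centered random variable $X$ of variance $1$ is called strictly subgaussian if $\mathbb{E}[\exp(sX)]\le\exp(s^2/2)$ for all $s\in\mathbb{R}$. Here $\log$ is the natural logarithm. The common law of the $J_{i,j}$ does not depend on $N$. *)

(* Defs.v *)
From HB Require Import structures.
From mathcomp Require Import all_boot all_order all_algebra.
From mathcomp Require Import all_classical all_reals all_analysis.

Set Implicit Arguments.
Unset Strict Implicit.
Unset Printing Implicit Defensive.

Import Order.TTheory GRing.Theory Num.Theory.
Import numFieldNormedType.Exports.

Local Open Scope classical_set_scope.
Local Open Scope ring_scope.

Definition strictly_subgaussian (d : measure_display) (T : measurableType d)
    (R : realType) (P : probability T R) (X : {RV P >-> R}) : Prop :=
  [/\ ('E_P[X])%E = 0%:E, ('V_P[X])%E = 1%:E &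
      forall s : R, (mmt_gen_fun P X s <= (expR (s ^+ 2 / 2))%:E)%E].

(* The two variables may live on different probability spaces. *)
Definition same_law (d d' : measure_display) (T : measurableType d)
    (T' : measurableType d') (R : realType) (P : probability T R)
    (Q : probability T' R) (X : {RV P >-> R}) (Y : {RV Q >-> R}) : Prop :=
  forall A : set R, measurable A -> distribution P X A = distribution Q Y A.

Definition mutually_independent (d : measure_display) (T : measurableType d)
    (R : realType) (P : probability T R) (I : finType)
    (X : I -> {RV P >-> R}) : Prop :=
  forall (S : {set I}) (A : I -> set R), (forall i, measurable (A i)) ->
    P (\bigcap_(i in [set` S]) (X i @^-1` A i)) =
    (\prod_(i in S) P (X i @^-1` A i))%E.

Section Hamiltonian.
Context (R : realType) (N : nat).
Implicit Types (J : 'I_N -> 'I_N -> R) (eta : {ffun 'I_N -> bool}) (m : R).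

Definition hamiltonian J eta : R :=
  (Num.sqrt N%:R)^-1 *
  \sum_(i < N) \sum_(j < N) J i j * (eta i)%:R * (eta j)%:R.

Definition nu_minus J m : nat :=
  #|[pred eta | hamiltonian J eta <= - (m * N%:R)]|.

Definition nu_plus J m : nat :=
  #|[pred eta | hamiltonian J eta >= m * N%:R]|.

End Hamiltonian.

Section Threshold.
Context (R : realType).
Implicit Types m alpha : R.

Definition entropy alpha : R :=
  - alpha * ln alpha - (1 - alpha) * ln (1 - alpha).

Definition rate m alpha : R :=
  entropy alpha - m ^+ 2 / (2 * alpha ^+ 2 * (1 - alpha ^+ 2)).

Definition no_zeros_beyond m : Prop :=
  forall m' alpha, m < m' -> 0 < alpha < 1 -> rate m' alpha <> 0.

Definition m_star : R := inf [set m | 0 < m /\ no_zeros_beyond m].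

End Threshold.

Arguments m_star R : clear implicits.

(* Main.v *)
(* Let S be the sum of all entries over sqrt N; S > eps N has exponentially
   small probability. If S <= eps N, a configuration of density a with
   H >= m N satisfies H - a^2 S >= (m - a^2 eps) N, and H - a^2 S has variance
   N a^2 (1 - a^2): Chernoff's bound and the entropy count give the exponent
   rate m a, up to O(eps). At m = m_star this exponent is only <= 0, and it
   vanishes at alpha_star, so an extra gain is needed: it suffices to count the
   maximisers of H. At a maximiser, for each empty site i, the sum G_i of the
   entries in row and column i whose other index is occupied, or i itself, is
   <= 0. The G_i are independent of each other and of H, and under the tilt each
   constraint G_i <= 0 costs a factor bounded away from 1, because G_i is
   centered with variance of order N and controlled fourth moment. Away from
   alpha_star, namely for a < 1/2 or a > 9/10, the crude count 2^N suffices.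

   The rate has the sign of energy a - m^2 with energy a = 2 a^2 (1 - a^2) I(a),
   so m_star^2 is the maximum of energy; its maximiser is located by the sign of
   the derivative at 0.6435 and 0.6445. *)
Require Import Defs.
From HB Require Import structures.
From mathcomp Require Import all_boot all_order all_algebra.
From mathcomp Require Import all_classical all_reals all_analysis.
From mathcomp Require Import measurable_realfun.
From mathcomp Require Import ring lra zify.

Set Implicit Arguments.
Unset Strict Implicit.
Unset Printing Implicit Defensive.

Import Order.TTheory GRing.Theory Num.Theory.
Import numFieldNormedType.Exports.

Local Open Scope classical_set_scope.
Local Open Scope ring_scope.

(** * The threshold *)

Section RealDerivative.
Context {R : realType}.
Implicit Types (f g : R -> R) (x : R).

Lemma is_deriveD_fun f g x (df dg : R) : is_derive x 1 f df -> is_derive x 1 g dg ->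
  is_derive x 1 (fun y => f y + g y) (df + dg).
Proof. by move=> ? ?; exact: is_deriveD. Qed.

Lemma is_deriveB_fun f g x (df dg : R) : is_derive x 1 f df -> is_derive x 1 g dg ->
  is_derive x 1 (fun y => f y - g y) (df - dg).
Proof. by move=> ? ?; exact: is_deriveB. Qed.

Lemma is_deriveM_fun f g x (df dg : R) : is_derive x 1 f df -> is_derive x 1 g dg ->
  is_derive x 1 (fun y => f y * g y) (df * g x + f x * dg).
Proof.
by move=> ? ?; apply: is_derive_eq; rewrite addrC [X in X + _]mulrC.
Qed.

Lemma is_deriveZ_fun f (c : R) x (df : R) : is_derive x 1 f df ->
  is_derive x 1 (fun y => c * f y) (c * df).
Proof. by move=> ?; exact: is_deriveZ. Qed.

Lemma is_deriveXn_fun n x : is_derive x 1 (fun y : R => y ^+ n) (n%:R * x ^+ n.-1).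
Proof.
have H := @is_deriveX R R id n x 1 1 (is_derive_id _ _).
rewrite (_ : (fun y => _) = id ^+ n); last by apply/funext => y; rewrite fctE.
by apply: (is_derive_eq H); rewrite /GRing.scale/= mulr1.
Qed.

Lemma is_derive_ln1D x : -1 < x -> is_derive x 1 (fun y : R => ln (1 + y)) (1 + x)^-1.
Proof.
move=> x1.
have H1 := is_deriveD_fun (is_derive_cst (1 : R) x 1) (is_derive_id x 1).
have x0 : 0 < 1 + x by lra.
have H2 := @is_derive1_comp R (@ln R) (fun y => 1 + y) x _ _ (is_derive1_ln x0) H1.
by apply: (is_derive_eq H2); rewrite add0r mulr1.
Qed.

Lemma is_derive_ln1B x : x < 1 -> is_derive x 1 (fun y : R => ln (1 - y)) (- (1 - x)^-1).
Proof.
move=> x1.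
have H1 := is_deriveB_fun (is_derive_cst (1 : R) x 1) (is_derive_id x 1).
have x0 : 0 < 1 - x by lra.
have H2 := @is_derive1_comp R (@ln R) (fun y => 1 - y) x _ _ (is_derive1_ln x0) H1.
by apply: (is_derive_eq H2); rewrite sub0r mulrN1.
Qed.

Lemma is_derive_continuous f x (df : R) : is_derive x 1 f df -> {for x, continuous f}.
Proof.
by case=> /derivable1_diffP /differentiable_continuous.
Qed.

Lemma is_derive_within_continuous f (a b : R) (df : R -> R) :
  (forall x, a <= x <= b -> is_derive x 1 f (df x)) -> {within `[a, b], continuous f}.
Proof.
move=> df_; apply: continuous_in_subspaceT => x; rewrite inE/= in_itv/= => xab.
exact: is_derive_continuous (df_ x xab).
Qed.

Lemma ge0_is_derive_le f (df : R -> R) (a b : R) : a <= b ->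
  (forall x, a <= x <= b -> is_derive x 1 f (df x)) ->
  (forall x, a <= x <= b -> 0 <= df x) -> f a <= f b.
Proof.
move=> ab dfx df0.
have [||c] := @MVT_segment R f df a b ab.
- by move=> x; rewrite in_itv/= => /andP[ax xb]; apply: dfx; rewrite !ltW.
- exact: is_derive_within_continuous.
rewrite in_itv/= => cab fE.
by rewrite -subr_ge0 fE mulr_ge0 ?subr_ge0// df0.
Qed.

Lemma le0_is_derive_ge f (df : R -> R) (a b : R) : a <= b ->
  (forall x, a <= x <= b -> is_derive x 1 f (df x)) ->
  (forall x, a <= x <= b -> df x <= 0) -> f b <= f a.
Proof.
move=> ab dfx df0; rewrite -lerN2.
apply: (@ge0_is_derive_le (fun x => - f x) (fun x => - df x)) => // x xab.
  have := dfx x xab => ?; exact: is_deriveN.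
by rewrite oppr_ge0 df0.
Qed.

(** The Taylor polynomial of degree 9 of 2 artanh t = ln ((1 + t) / (1 - t)). *)
Definition atanh_sum (t : R) : R :=
  2 * (t + (3^-1 * t ^+ 3 + (5^-1 * t ^+ 5 + (7^-1 * t ^+ 7 + 9^-1 * t ^+ 9)))).

Lemma is_derive_atanh_sum x :
  is_derive x 1 atanh_sum (2 * (1 + x ^+ 2 + x ^+ 4 + x ^+ 6 + x ^+ 8)).
Proof.
have h (n : nat) : is_derive x 1 (fun y : R => n.+1%:R^-1 * y ^+ n.+1) (x ^+ n).
  have := is_deriveXn_fun n.+1 x => /(is_deriveZ_fun n.+1%:R^-1).
  by rewrite mulrA mulVf ?mul1r// pnatr_eq0.
have := is_deriveD_fun (is_derive_id x 1) (is_deriveD_fun (h 2) (is_deriveD_fun (h 4)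
    (is_deriveD_fun (h 6) (h 8)))).
move=> /(is_deriveZ_fun 2) H; apply: is_derive_eq H _; ring.
Qed.

(** Both sides vanish at 0, and their derivatives differ by the tail 2 x^10 / (1 - x^2) of a
    geometric series. *)
Lemma ln_atanh_lb (t : R) : 0 <= t < 1 -> atanh_sum t <= ln (1 + t) - ln (1 - t).
Proof.
move=> /andP[t0 t1]; rewrite -subr_ge0.
pose f x := ln (1 + x) - ln (1 - x) - atanh_sum x.
have f0 : f 0 = 0 by rewrite /f /atanh_sum subr0 addr0 !expr0n/=; ring.
rewrite -/(f t) -f0.
apply: (ge0_is_derive_le (f := f) (df := fun x => (1 + x)^-1 - - (1 - x)^-1 -
   2 * (1 + x ^+ 2 + x ^+ 4 + x ^+ 6 + x ^+ 8)) t0) => x /andP[x0 xt].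
  apply: is_deriveB_fun; last exact: is_derive_atanh_sum.
  by apply: is_deriveB_fun; [apply: is_derive_ln1D|apply: is_derive_ln1B]; lra.
have -> : (1 + x)^-1 - - (1 - x)^-1 - 2 * (1 + x ^+ 2 + x ^+ 4 + x ^+ 6 + x ^+ 8)
   = 2 * x ^+ 10 / ((1 + x) * (1 - x)).
  by field; apply/andP; split; lra.
by rewrite divr_ge0 ?mulr_ge0 ?exprn_ge0//; lra.
Qed.

(** On [0, t] the tail 2 x^10 / (1 - x^2) is at most 2 x^10 / (1 - t^2), whose integral is the
    remainder term. *)
Lemma ln_atanh_ub (t : R) : 0 <= t < 1 ->
  ln (1 + t) - ln (1 - t) <= atanh_sum t + 2 / 11 / (1 - t ^+ 2) * t ^+ 11.
Proof.
move=> /andP[t0 t1]; rewrite -subr_ge0.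
set c := (2 / 11) / _.
pose f x := atanh_sum x + c * x ^+ 11 - (ln (1 + x) - ln (1 - x)).
have f0 : f 0 = 0 by rewrite /f /atanh_sum subr0 addr0 !expr0n/=; ring.
rewrite -/(f t) -f0.
apply: (ge0_is_derive_le (f := f) (df := fun x =>
   2 * (1 + x ^+ 2 + x ^+ 4 + x ^+ 6 + x ^+ 8) + c * (11%:R * x ^+ 10) -
   ((1 + x)^-1 - - (1 - x)^-1)) t0) => x /andP[x0 xt].
  apply: is_deriveB_fun.
    apply: is_deriveD_fun; first exact: is_derive_atanh_sum.
    by apply: is_deriveZ_fun; exact: is_deriveXn_fun 11 x.
  by apply: is_deriveB_fun; [apply: is_derive_ln1D|apply: is_derive_ln1B]; lra.
have -> : 2 * (1 + x ^+ 2 + x ^+ 4 + x ^+ 6 + x ^+ 8) + c * (11%:R * x ^+ 10) -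
   ((1 + x)^-1 - - (1 - x)^-1)
   = 2 * x ^+ 10 * ((1 - t ^+ 2)^-1 - (1 - x ^+ 2)^-1).
  rewrite /c; field; do ![apply/andP; split]; nra.
rewrite mulr_ge0 ?mulr_ge0 ?exprn_ge0// subr_ge0 lef_pV2 ?posrE; nra.
Qed.

End RealDerivative.

(** * Numerical enclosures of four logarithms *)

Section ThresholdEnergy.
Context {R : realType}.
Implicit Types (x y p t m : R).

(** Here p = (1 - t) / (1 + t). The free [c] lets a short decimal replace the exact coefficient of
    the remainder. *)
Lemma ln_atanh_bounds p t c : 0 <= t < 1 -> p * (1 + t) = 1 - t ->
  2 / 11 <= c * (1 - t ^+ 2) -> atanh_sum t <= - ln p <= atanh_sum t + c * t ^+ 11.
Proof.
move=> t01 pt ct; case/andP: (t01) => t0 t1.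
have -> : - ln p = ln (1 + t) - ln (1 - t).
  have p0 : 0 < p by rewrite -(pmulr_lgt0 (x := 1 + t)) 1?pt; lra.
  by rewrite -pt lnM ?posrE; lra.
rewrite ln_atanh_lb//= (le_trans (ln_atanh_ub t01))// lerD2l.
by rewrite ler_wpM2r ?exprn_ge0// ler_pdivrMr//; nra.
Qed.

(* Numerals of type [R] are unary, hence the decimals are split. *)
Lemma ln_6435 p : p = 64 / 100 + 35 / 100 / 100 ->
  440 / 1000 + 83 / 100 / 1000 <= - ln p <= 440 / 1000 + 84 / 100 / 1000.
Proof.
(* This is (1 - p) / (1 + p) in lowest terms, factored to keep the numerals small. *)
move=> pE; have [t tE] : exists t : R, t = 23 * 31 / (19 * 173) by eexists.
have t01 : 0 <= t < 1 by rewrite tE; lra.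
have pt : p * (1 + t) = 1 - t by rewrite pE tE; lra.
have ct : 2 / 11 <= 20 / 100 * (1 - t ^+ 2) by rewrite tE; lra.
have /andP[l u] := ln_atanh_bounds t01 pt ct.
by apply/andP; split; [apply: le_trans l|apply: le_trans u _];
  rewrite /atanh_sum tE; lra.
Qed.

Lemma ln_3565 p : p = 35 / 100 + 65 / 100 / 100 ->
  1 + 31 / 1000 + 35 / 100 / 1000 <= - ln p <= 1 + 31 / 1000 + 45 / 100 / 1000.
Proof.
move=> pE; have [t tE] : exists t : R, t = 9 * 11 * 13 / 2713 by eexists.
have t01 : 0 <= t < 1 by rewrite tE; lra.
have pt : p * (1 + t) = 1 - t by rewrite pE tE; lra.
have ct : 2 / 11 <= 24 / 100 * (1 - t ^+ 2) by rewrite tE; lra.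
have /andP[l u] := ln_atanh_bounds t01 pt ct.
by apply/andP; split; [apply: le_trans l|apply: le_trans u _];
  rewrite /atanh_sum tE; lra.
Qed.

Lemma ln_6445 p : p = 64 / 100 + 45 / 100 / 100 ->
  439 / 1000 + 27 / 100 / 1000 <= - ln p <= 439 / 1000 + 29 / 100 / 1000.
Proof.
move=> pE; have [t tE] : exists t : R, t = 9 * 79 / (11 * 13 * 23) by eexists.
have t01 : 0 <= t < 1 by rewrite tE; lra.
have pt : p * (1 + t) = 1 - t by rewrite pE tE; lra.
have ct : 2 / 11 <= 20 / 100 * (1 - t ^+ 2) by rewrite tE; lra.
have /andP[l u] := ln_atanh_bounds t01 pt ct.
by apply/andP; split; [apply: le_trans l|apply: le_trans u _];
  rewrite /atanh_sum tE; lra.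
Qed.

Lemma ln_3555 p : p = 35 / 100 + 55 / 100 / 100 ->
  1 + 34 / 1000 + 15 / 100 / 1000 <= - ln p <= 1 + 34 / 1000 + 26 / 100 / 1000.
Proof.
move=> pE; have [t tE] : exists t : R, t = (12 * 100 + 89) / 2711 by eexists.
have t01 : 0 <= t < 1 by rewrite tE; lra.
have pt : p * (1 + t) = 1 - t by rewrite pE tE; lra.
have ct : 2 / 11 <= 24 / 100 * (1 - t ^+ 2) by rewrite tE; lra.
have /andP[l u] := ln_atanh_bounds t01 pt ct.
by apply/andP; split; [apply: le_trans l|apply: le_trans u _];
  rewrite /atanh_sum tE; lra.
Qed.

End ThresholdEnergy.

(** * The maximum of the energy and the value of [m_star] *)

Section Threshold.
Context {R : realType}.
Implicit Types (x y a m : R).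

Lemma is_derive_entropy x : 0 < x < 1 ->
  is_derive x 1 (@entropy R) (ln (1 - x) - ln x).
Proof.
move=> /andP[x0 x1].
have dl := is_derive1_ln x0.
have d1 := is_derive_ln1B x1.
have dN : is_derive x 1 (fun y : R => - y) (- 1) by exact: is_deriveNid.
have dB : is_derive x 1 (fun y : R => 1 - y) (- 1).
  by have := is_deriveB_fun (is_derive_cst (1 : R) x 1) (is_derive_id x 1); rewrite sub0r.
have H := is_deriveB_fun (is_deriveM_fun dN dl) (is_deriveM_fun dB d1).
apply: (is_derive_eq H); field; apply/andP; split; lra.
Qed.

Lemma entropy_ge0 x : 0 < x < 1 -> 0 <= entropy x.
Proof.
move=> /andP[x0 x1]; rewrite /entropy.
have h1 : ln x <= 0 by apply: ln_le0; exact: ltW.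
have h2 : ln (1 - x) <= 0 by apply: ln_le0; lra.
nra.
Qed.

Lemma ln_sub_le0 x : 1 / 2 <= x < 1 -> ln (1 - x) - ln x <= 0.
Proof. by move=> /andP[x0 x1]; rewrite subr_le0 ler_ln ?posrE; lra. Qed.

Lemma entropy_noninc x y : 1 / 2 <= x -> x <= y -> y < 1 -> entropy y <= entropy x.
Proof.
move=> x0 xy y1; apply: (le0_is_derive_ge (df := fun x => ln (1 - x) - ln x) xy).
  by move=> z /andP[xz zy]; apply: is_derive_entropy; lra.
by move=> z /andP[xz zy]; apply: ln_sub_le0; lra.
Qed.

Lemma entropy_derivative_noninc x y : 0 < x -> x <= y -> y < 1 ->
  ln (1 - y) - ln y <= ln (1 - x) - ln x.
Proof. by move=> x0 xy y1; apply: lerB; rewrite ler_ln ?posrE; lra. Qed.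

(* [rate m x] and [energy x - m ^+ 2] have the same sign. *)
Definition energy x := 2 * x ^+ 2 * (1 - x ^+ 2) * entropy x.

Definition energy_slope x :=
  (2 - 4 * x ^+ 2) * entropy x + x * (1 - x ^+ 2) * (ln (1 - x) - ln x).

Lemma is_derive_energy x : 0 < x < 1 ->
  is_derive x 1 energy (2 * x * energy_slope x).
Proof.
move=> x01; have d2 := is_deriveXn_fun 2 x.
have dB := is_deriveB_fun (is_derive_cst (1 : R) x 1) d2.
have H := is_deriveM_fun (is_deriveM_fun (is_deriveZ_fun 2 d2) dB) (is_derive_entropy x01).
by apply: (is_derive_eq H); rewrite /energy_slope /cst/=; ring.
Qed.

(* The ratio of the coefficients of [entropy x] and of its derivative in
   [energy_slope x] is decreasing in [x]. *)
Lemma slope_ratio_noninc x y : 0 < x -> x <= y -> y < 1 ->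
  (2 - 4 * y ^+ 2) * (x * (1 - x ^+ 2)) <= (2 - 4 * x ^+ 2) * (y * (1 - y ^+ 2)).
Proof.
move=> x0 xy y1; rewrite -subr_ge0.
have -> : (2 - 4 * x ^+ 2) * (y * (1 - y ^+ 2)) - (2 - 4 * y ^+ 2) * (x * (1 - x ^+ 2)) =
  (y - x) * (2 * (1 - (y ^+ 2 - x * (y - x))) + 4 * (x * y) ^+ 2 ) by ring.
have h : y ^+ 2 - x * (y - x) <= 1 by nra.
have h2 : 0 <= (x * y) ^+ 2 by rewrite sqr_ge0.
apply: mulr_ge0; first lra.
by apply: addr_ge0; apply: mulr_ge0 => //; lra.
Qed.

(** Divided by x (1 - x^2), the slope is a coefficient ratio times the entropy, plus the derivative
    of the entropy. On [1/2, a] ratio, entropy and derivative are nonincreasing and the first two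
    nonnegative, so the sign at [a] propagates to the left; below 1/2 both terms of the slope are
    nonnegative. Cross-multiplication avoids the divisions. *)
Lemma energy_slope_ge0 a x : 1 / 2 <= a -> a < 1 -> 4 * a ^+ 2 <= 2 ->
  0 <= energy_slope a -> 0 < x <= a -> 0 <= energy_slope x.
Proof.
move=> a0 a1 a2 Ka /andP[x0 xa].
have Ix : 0 <= entropy x by apply: entropy_ge0; lra.
have c0 : 0 < x * (1 - x ^+ 2) by apply: mulr_gt0 => //; nra.
have [x2|x2] := leP x (1 / 2).
  have : 0 <= ln (1 - x) - ln x by rewrite subr_ge0 ler_ln ?posrE; lra.
  move=> h; rewrite /energy_slope addr_ge0// mulr_ge0//; [nra|exact: ltW].
have ca : 0 < a * (1 - a ^+ 2) by apply: mulr_gt0; nra.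
rewrite -(pmulr_rge0 _ ca).
apply: (@le_trans _ _ (x * (1 - x ^+ 2) * energy_slope a)).
  by rewrite mulr_ge0// ltW.
have Ia : entropy a <= entropy x by apply: entropy_noninc; lra.
have Ia0 : 0 <= entropy a by apply: entropy_ge0; lra.
have Da := entropy_derivative_noninc x0 xa a1.
have q := slope_ratio_noninc x0 xa a1.
have q0 : 0 <= (2 - 4 * a ^+ 2) * (x * (1 - x ^+ 2)).
  by apply: mulr_ge0; [lra|exact: ltW].
have h1 := ler_pM q0 Ia0 q Ia.
have W0 : 0 <= x * (1 - x ^+ 2) * (a * (1 - a ^+ 2)) by apply: mulr_ge0; exact: ltW.
have h2 := ler_wpM2l W0 Da.
have -> : x * (1 - x ^+ 2) * energy_slope a =
    (2 - 4 * a ^+ 2) * (x * (1 - x ^+ 2)) * entropy a +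
    x * (1 - x ^+ 2) * (a * (1 - a ^+ 2)) * (ln (1 - a) - ln a).
  by rewrite /energy_slope; ring.
have -> : a * (1 - a ^+ 2) * energy_slope x =
    (2 - 4 * x ^+ 2) * (a * (1 - a ^+ 2)) * entropy x +
    x * (1 - x ^+ 2) * (a * (1 - a ^+ 2)) * (ln (1 - x) - ln x).
  by rewrite /energy_slope; ring.
exact: lerD.
Qed.

(** The same comparison to the right of [a]. Since 2 - 4 x^2 may become negative, the coefficient is
    replaced first, against [entropy x], and the entropy only afterwards, against the nonnegative
    coefficient at [a]. *)
Lemma energy_slope_le0 a x : 1 / 2 <= a -> a <= x -> x < 1 -> 0 <= 2 - 4 * a ^+ 2 ->
  energy_slope a <= 0 -> energy_slope x <= 0.
Proof.
move=> a0 ax x1 a2 Ka.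
have x0 : 0 < x by lra.
have a1 : a < 1 by lra.
have Ix : 0 <= entropy x by apply: entropy_ge0; lra.
have c0 : 0 < x * (1 - x ^+ 2) by apply: mulr_gt0 => //; nra.
have ca : 0 < a * (1 - a ^+ 2) by apply: mulr_gt0; nra.
have Ia : entropy x <= entropy a by apply: entropy_noninc; lra.
have Ia0 : 0 <= entropy a by apply: entropy_ge0; lra.
rewrite -(pmulr_rle0 _ ca).
apply: (@le_trans _ _ (x * (1 - x ^+ 2) * energy_slope a)); last first.
  by rewrite pmulr_rle0.
have -> : x * (1 - x ^+ 2) * energy_slope a =
    (2 - 4 * a ^+ 2) * (x * (1 - x ^+ 2)) * entropy a +
    x * (1 - x ^+ 2) * (a * (1 - a ^+ 2)) * (ln (1 - a) - ln a).
  by rewrite /energy_slope; ring.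
have -> : a * (1 - a ^+ 2) * energy_slope x =
    (2 - 4 * x ^+ 2) * (a * (1 - a ^+ 2)) * entropy x +
    x * (1 - x ^+ 2) * (a * (1 - a ^+ 2)) * (ln (1 - x) - ln x).
  by rewrite /energy_slope; ring.
apply: lerD; last first.
  apply: ler_wpM2l; first by apply: mulr_ge0; exact: ltW.
  by apply: entropy_derivative_noninc; lra.
have q : (2 - 4 * x ^+ 2) * (a * (1 - a ^+ 2)) <= (2 - 4 * a ^+ 2) * (x * (1 - x ^+ 2)).
  by apply: slope_ratio_noninc; lra.
apply: (@le_trans _ _ ((2 - 4 * a ^+ 2) * (x * (1 - x ^+ 2)) * entropy x)).
  exact: ler_wpM2r.
by apply: ler_wpM2l => //; apply: mulr_ge0 => //; exact: ltW.
Qed.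

(** The two ends of the interval 0.644 ± 1/2000. *)
Definition alpha_lo : R := 64 / 100 + 35 / 100 / 100.
Definition alpha_hi : R := 64 / 100 + 45 / 100 / 100.

Lemma energy_slope_lo : 0 <= energy_slope alpha_lo.
Proof.
rewrite /energy_slope /entropy.
have -> : 1 - alpha_lo = 35 / 100 + 65 / 100 / 100 by rewrite /alpha_lo; lra.
have /andP[l1 u1] := @ln_6435 R _ (erefl alpha_lo).
have /andP[l2 u2] := @ln_3565 R _ erefl.
move: l1 u1 l2 u2; set L1 := ln _; set L2 := ln _ => l1 u1 l2 u2.
rewrite /alpha_lo; lra.
Qed.

Lemma energy_slope_hi : energy_slope alpha_hi <= 0.
Proof.
rewrite /energy_slope /entropy.
have -> : 1 - alpha_hi = 35 / 100 + 55 / 100 / 100 by rewrite /alpha_hi; lra.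
have /andP[l1 u1] := @ln_6445 R _ (erefl alpha_hi).
have /andP[l2 u2] := @ln_3555 R _ erefl.
move: l1 u1 l2 u2; set L1 := ln _; set L2 := ln _ => l1 u1 l2 u2.
rewrite /alpha_hi; lra.
Qed.

Lemma entropy_lo : 65 / 100 <= entropy alpha_lo <= 65 / 100 + 14 / 100 / 100.
Proof.
rewrite /entropy.
have -> : 1 - alpha_lo = 35 / 100 + 65 / 100 / 100 by rewrite /alpha_lo; lra.
have /andP[l1 u1] := @ln_6435 R _ (erefl alpha_lo).
have /andP[l2 u2] := @ln_3565 R _ erefl.
move: l1 u1 l2 u2; set L1 := ln _; set L2 := ln _ => l1 u1 l2 u2.
rewrite /alpha_lo; lra.
Qed.

(** The maximum over the compact bracket is global because the energy increases to the left of it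
    and decreases to the right. The squares in the last bound confine the threshold to 0.562 ±
    1/2000. *)
Lemma energy_max : exists c : R, [/\ alpha_lo <= c <= alpha_hi,
  forall x, 0 < x < 1 -> energy x <= energy c &
  (56 / 100 + 15 / 100 / 100) ^+ 2 <= energy c <= (56 / 100 + 25 / 100 / 100) ^+ 2].
Proof.
have lohi : alpha_lo <= alpha_hi by rewrite /alpha_lo /alpha_hi; lra.
have lo0 : 1 / 2 <= alpha_lo by rewrite /alpha_lo; lra.
have hi1 : alpha_hi < 1 by rewrite /alpha_hi; lra.
have hi2 : 0 <= 2 - 4 * alpha_hi ^+ 2 by rewrite /alpha_hi; lra.
have lo2 : 4 * alpha_lo ^+ 2 <= 2 by rewrite /alpha_lo; lra.
have [|c] := @EVT_max R energy alpha_lo alpha_hi lohi.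
  apply: (@is_derive_within_continuous _ _ _ _ (fun x => 2 * x * energy_slope x)) => x /andP[h1 h2].
  by apply: is_derive_energy; lra.
rewrite in_itv/= => cin maxc; exists c.
have cmax x : 0 < x < 1 -> energy x <= energy c.
  move=> /andP[x0 x1].
  have [xlo|/ltW xlo] := leP x alpha_lo.
    apply: (@le_trans _ _ (energy alpha_lo)); last by apply: maxc; rewrite in_itv/= lexx.
    apply: (ge0_is_derive_le (df := fun x => 2 * x * energy_slope x) xlo) => z /andP[xz za].
      by apply: is_derive_energy; lra.
    apply: mulr_ge0; first lra.
    by apply: (energy_slope_ge0 lo0 _ lo2 energy_slope_lo); lra.
  have [xhi|/ltW xhi] := leP x alpha_hi.
    by apply: maxc; rewrite in_itv/= xlo.
  apply: (@le_trans _ _ (energy alpha_hi)); last by apply: maxc; rewrite in_itv/= lexx lohi.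
  apply: (le0_is_derive_ge (df := fun x => 2 * x * energy_slope x) xhi) => z /andP[xz za].
    by apply: is_derive_energy; lra.
  apply: mulr_ge0_le0; first lra.
  by apply: (energy_slope_le0 _ xz _ hi2 energy_slope_hi); lra.
have /andP[I1 I2] := entropy_lo.
split=> //; apply/andP; split.
  apply: (@le_trans _ _ (energy alpha_lo)); last by apply: cmax; lra.
  apply: (@le_trans _ _ (2 * alpha_lo ^+ 2 * (1 - alpha_lo ^+ 2) * (65 / 100))).
    by rewrite /alpha_lo; lra.
  by apply: ler_wpM2l => //; rewrite /alpha_lo; lra.
(* For the upper bound the two factors are estimated at opposite ends: the entropy decreases, while
   x^2 (1 - x^2) increases as long as x^2 is at most 1/2. *)
case/andP: cin => c1 c2.
have Ic : entropy c <= 65 / 100 + 14 / 100 / 100.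
  by apply: le_trans I2; apply: entropy_noninc; lra.
have Ic0 : 0 <= entropy c by apply: entropy_ge0; lra.
have h : 2 * c ^+ 2 * (1 - c ^+ 2) <= 2 * alpha_hi ^+ 2 * (1 - alpha_hi ^+ 2).
  rewrite -subr_ge0.
  have -> : 2 * alpha_hi ^+ 2 * (1 - alpha_hi ^+ 2) - 2 * c ^+ 2 * (1 - c ^+ 2) =
    2 * ((alpha_hi - c) * (alpha_hi + c)) * (1 - (alpha_hi ^+ 2 + c ^+ 2)) by ring.
  by apply: mulr_ge0; [rewrite mulr_ge0 ?mulr_ge0//; lra|nra].
have h0 : 0 <= 2 * c ^+ 2 * (1 - c ^+ 2) by apply: mulr_ge0; nra.
apply: le_trans (ler_pM h0 Ic0 h Ic) _.
by rewrite /alpha_hi; lra.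
Qed.

Lemma rate_energy m x : 0 < x < 1 ->
  rate m x * (2 * x ^+ 2 * (1 - x ^+ 2)) = energy x - m ^+ 2.
Proof.
move=> /andP[x0 x1]; rewrite /rate /energy; field.
by do ![apply/andP; split]; nra.
Qed.

Let energy_weight_gt0 x : 0 < x < 1 -> 0 < 2 * x ^+ 2 * (1 - x ^+ 2).
Proof. by move=> /andP[x0 x1]; rewrite mulr_gt0//; nra. Qed.

(** A zero of [rate m] is a point where the energy equals m^2, so the infimum is attained at the
    square root of the maximal energy. *)
Lemma m_starP : exists c : R, [/\ alpha_lo <= c <= alpha_hi, rate (m_star R) c = 0,
  forall x, 0 < x < 1 -> rate (m_star R) x <= 0 &
  56 / 100 + 15 / 100 / 100 <= m_star R <= 56 / 100 + 25 / 100 / 100].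
Proof.
have [c [cin cmax /andP[c1 c2]]] := energy_max.
have c01 : 0 < c < 1 by move: cin; rewrite /alpha_lo /alpha_hi => /andP[? ?]; lra.
have M0 : 0 < energy c by apply: lt_le_trans c1; lra.
pose s := Num.sqrt (energy c).
have s0 : 0 < s by rewrite sqrtr_gt0.
have s2 : s ^+ 2 = energy c by rewrite sqr_sqrtr// ltW.
have rate_eq0 m x : 0 < x < 1 -> rate m x = 0 <-> energy x = m ^+ 2.
  move=> x01; have w0 := energy_weight_gt0 x01; have E := rate_energy m x01.
  split=> [r0|e0]; first by move: E; rewrite r0 mul0r => /esym/eqP; rewrite subr_eq0 => /eqP.
  move: E; rewrite e0 subrr => /eqP; rewrite mulf_eq0 => /orP[/eqP//|/eqP w].
  by move: w0; rewrite w ltxx.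
have ms : m_star R = s.
  rewrite /m_star; set S := [set m | _].
  have Ss : S s.
    split=> // m' a sm' a01 /(rate_eq0 _ _ a01) E.
    have := cmax a a01; rewrite E -s2 leNgt => /negP; apply.
    by rewrite ltr_pXn2r// nnegrE; lra.
  (* A smaller [m] in [S] would rule out a zero of [rate s], but [c] is one. *)
  have Slb : lbound S s.
    move=> m [m0 nz]; rewrite leNgt; apply/negP => ms.
    exact: (nz s c ms c01) (proj2 (rate_eq0 s c c01) (esym s2)).
  apply/eqP; rewrite eq_le; apply/andP; split.
    by apply: ge_inf => //; exists s.
  by apply: lb_le_inf => //; exists s.
rewrite ms; exists c; split=> //.
- by apply/rate_eq0.
- move=> x x01; have w0 := energy_weight_gt0 x01.
  by rewrite -(pmulr_lle0 _ w0) rate_energy// subr_le0 s2 cmax.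
- rewrite -s2 in c1 c2.
  apply/andP; split; rewrite -(@ler_pXn2r _ 2)// nnegrE; lra.
Qed.

End Threshold.

(** * Independent blocks of random variables *)

Section Independence.
Context d (T : measurableType d) (R : realType) (P : probability T R).
Context (I : finType) (X : I -> {RV P >-> R}).
Implicit Types (B C : {set I}) (E F : set T) (Y Z : T -> R).

(** The events to which mutual independence applies; they form a pi-system generating the
    sigma-algebra of the variables indexed by [B]. *)
Definition cylinders B : set (set T) := [set E | exists2 A : I -> set R,
  forall i, measurable (A i) & E = \bigcap_(i in [set` B]) (X i @^-1` A i)].

Lemma cylinders_measurable B : cylinders B `<=` measurable.
Proof.
move=> _ [A mA ->]; apply: fin_bigcap_measurable => // i _.
exact: measurable_funPTI.
Qed.

Lemma cylindersT B : cylinders B setT.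
Proof.
by exists (fun=> setT) => //; apply/seteqP; split.
Qed.

Lemma cylinders_setI B : setI_closed (cylinders B).
Proof.
move=> _ _ [A mA ->] [A' mA' ->].
exists (fun i => A i `&` A' i); first by move=> i; exact: measurableI.
by rewrite -bigcapI.
Qed.

Definition block_measurable B Y :=
  @measurable_fun _ _ (g_sigma_algebraType (cylinders B)) R setT Y.

Lemma generated_sub B C : B \subset C -> <<s cylinders B >> `<=` <<s cylinders C >>.
Proof.
move=> /fintype.subsetP BC; apply: smallest_sub; first exact: smallest_sigma_algebra.
move=> _ [A mA ->]; apply: sub_sigma_algebra.
exists (fun i => if i \in B then A i else setT).
  by move=> i; case: ifP.
apply/seteqP; split=> w /= Hw i iC.
  by case: ifPn => // iB; apply: Hw.
by move: (Hw i (BC i iC)); rewrite iC.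
Qed.

Lemma block_measurableS B C Y :
  B \subset C -> block_measurable B Y -> block_measurable C Y.
Proof.
by move=> BC mY _ A mA; apply: generated_sub BC _ _; apply: mY.
Qed.

Lemma block_measurable_fun B Y : block_measurable B Y -> measurable_fun setT Y.
Proof.
move=> mY _ A mA; have := mY measurableT A mA.
apply: smallest_sub; first exact: sigma_algebra_measurable.
exact: cylinders_measurable.
Qed.

Lemma block_measurable_RV B i : i \in B -> block_measurable B (X i).
Proof.
move=> iB _ A mA; apply: sub_sigma_algebra.
exists (fun j => if j == i then A else setT); first by move=> j; case: ifP.
rewrite setTI; apply/seteqP; split=> w /= Hw.
  by move=> j _; case: ifPn => // /eqP ->.
by have := Hw i iB; rewrite eqxx.
Qed.

Hypothesis indepX : mutually_independent X.

(** The intersection is a cylinder over the union of the blocks, and the product over a disjoint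
    union splits. *)
Lemma indep_cylinders B C E F : [disjoint B & C]%B ->
  cylinders B E -> cylinders C F -> P (E `&` F) = (P E * P F)%E.
Proof.
move=> dBC [A mA ->] [A' mA' ->].
rewrite [in RHS]indepX// [in RHS]indepX//.
pose D i := if i \in B then A i else A' i.
have mD i : measurable (D i) by rewrite /D; case: ifP.
have -> : (\bigcap_(i in [set` B]) (X i @^-1` A i) `&`
          \bigcap_(i in [set` C]) (X i @^-1` A' i)) =
          \bigcap_(i in [set` B :|: C]) (X i @^-1` D i).
  apply/seteqP; split => w /=.
    move=> [HB HC] i /=; rewrite inE /D => /orP[iB|iC].
      by rewrite iB; exact: HB.
    by case: ifPn => iB; [exact: HB|exact: HC].
  move=> HBC; split=> i /= iBC.
    have : D i (X i w) by apply: HBC; rewrite /= inE iBC.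
    by rewrite /D iBC.
  have : D i (X i w) by apply: HBC; rewrite /= inE iBC orbT.
  rewrite /D; case: ifPn => // iB.
  by move/pred0P: dBC => /(_ i) /=; rewrite iB iBC.
rewrite indepX// (eq_bigl (mem [predU B & C])); last first.
  by move=> i; rewrite !inE.
rewrite bigU//; congr (_ * _)%E; apply: eq_bigr => i.
  by rewrite /D => ->.
rewrite /D => iC; case: ifPn => // iB.
by move/pred0P: dBC => /(_ i) /=; rewrite iB; move: iC; rewrite /= => ->.
Qed.

(** The pi-lambda argument, applied to one block and then to the other. *)
Lemma indep_generated B C E F : [disjoint B & C]%B ->
  <<s cylinders B >> E -> <<s cylinders C >> F -> P (E `&` F) = (P E * P F)%E.
Proof.
(* For fixed [G], both sides are finite measures in [H] that agree on a pi-system containing the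
   whole space. *)
have extend D G : measurable G -> (forall H, cylinders D H -> P (H `&` G) = (P H * P G)%E) ->
    forall H, <<s cylinders D >> H -> P (H `&` G) = (P H * P G)%E.
  move=> mG HG H sH.
  have PG0 : 0 <= fine (P G) by rewrite fine_ge0.
  pose m2 := mscale (NngNum PG0) P.
  have -> : (P H * P G)%E = m2 H.
    by rewrite /m2 /mscale/= fineK ?fin_num_measure// muleC.
  rewrite -/(mrestr P mG H).
  apply: (@g_sigma_algebra_measure_unique _ _ _ (cylinders D) _ (fun=> setT)
     _ _ (mrestr P mG) m2) => //.
  - exact: cylinders_measurable.
  - by move=> _; exact: cylindersT.
  - by apply/seteqP; split => // w _; exists 0%N.
  - exact: cylinders_setI.
  - move=> K cK; rewrite /= /mrestr HG// /m2 /mscale/= fineK ?fin_num_measure//.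
    by rewrite muleC.
  - move=> _; rewrite /= /mrestr setTI (le_lt_trans (probability_le1 P mG))//.
    exact: ltry.
move=> dBC sE sF.
have mD D H : <<s cylinders D >> H -> measurable H.
  apply: smallest_sub; first exact: sigma_algebra_measurable.
  exact: cylinders_measurable.
apply: (extend B) => //; first exact: mD sF.
move=> H cH; rewrite setIC muleC; apply: (extend C) => //.
  exact: cylinders_measurable cH.
move=> K cK; apply: indep_cylinders cK cH.
by rewrite disjoint_sym.
Qed.

(** The joint law is the product of the marginals. The existentials bundle the bare functions as
    random variables, since [distribution] takes only those. *)
Lemma indep_product B C Y Z : [disjoint B & C]%B ->
    block_measurable B Y -> block_measurable C Z ->
  exists (Y' Z' : {RV P >-> R}) (V : {RV P >-> (R * R)%type}),
  [/\ Y' = Y :> (T -> R), Z' = Z :> (T -> R),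
      V = (fun w => (Y w, Z w)) :> (T -> R * R) &
  forall W, measurable W ->
    (distribution P Y' \x distribution P Z')%E W = distribution P V W].
Proof.
move=> dBC mY mZ.
have mY' := block_measurable_fun mY; have mZ' := block_measurable_fun mZ.
exists (mfun_Sub (mem_set mY')), (mfun_Sub (mem_set mZ')).
exists (mfun_Sub (mem_set (measurable_fun_pair mY' mZ'))); split=> //.
apply: product_measure_unique => A A' mA mA'.
rewrite /distribution /pushforward/=.
apply: (indep_generated dBC).
  by have := mY measurableT A mA; rewrite setTI.
by have := mZ measurableT A' mA'; rewrite setTI.
Qed.

Lemma indep_ge0_expectation B C Y Z : [disjoint B & C]%B ->
    block_measurable B Y -> block_measurable C Z ->
    (forall w, 0 <= Y w) -> (forall w, 0 <= Z w) ->
  (\int[P]_w (Y w * Z w)%:E = \int[P]_w (Y w)%:E * \int[P]_w (Z w)%:E)%E.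
Proof.
move=> dBC mY mZ Y0 Z0.
have [Y' [Z' [V [YE ZE VE mE]]]] := indep_product dBC mY mZ.
(* Absolute values make the integrand nonnegative on the whole plane, as Tonelli's theorem
   requires. *)
pose f (z : R * R) : \bar R := (`|z.1| * `|z.2|)%:E.
have mf : measurable_fun setT f.
  apply/measurable_EFinP; apply: measurable_funM.
    by apply: measurableT_comp => //; exact: measurable_fst.
  by apply: measurableT_comp => //; exact: measurable_snd.
have f0 z : (0 <= f z)%E by rewrite lee_fin mulr_ge0.
have mn : measurable_fun setT (fun x : R => (`|x|)%:E).
  by apply/measurable_EFinP; exact: normr_measurable.
transitivity (\int[distribution P Y' \x distribution P Z']_z f z)%E.
  rewrite (eq_measure_integral (distribution P V)); last by move=> A mA _; exact: mE.
  rewrite ge0_integral_distribution//.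
 apply: eq_integral => w _.
  have /(congr1 (@^~ w)) /= VwE := VE.
  by rewrite /f /= VwE/= ger0_norm// ger0_norm.
rewrite fubini_tonelli1//= /fubini_F /f/=.
under eq_integral => x _.
  under eq_integral => y _ do rewrite EFinM.
  rewrite ge0_integralZl//; over.
rewrite ge0_integralZr//; last by apply: integral_ge0.
rewrite !ge0_integral_distribution//.
by congr (_ * _)%E; apply: eq_integral => w _ /=; rewrite ?YE ?ZE ger0_norm.
Qed.

(** The nonnegative case for |Y| and |Z| gives integrability of the product; Fubini's theorem then
    applies. *)
Lemma indep_expectation B C Y Z : [disjoint B & C]%B ->
    block_measurable B Y -> block_measurable C Z ->
    P.-integrable setT (EFin \o Y) -> P.-integrable setT (EFin \o Z) ->
  P.-integrable setT (EFin \o (Y \* Z)) /\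
  (\int[P]_w (Y w * Z w)%:E = \int[P]_w (Y w)%:E * \int[P]_w (Z w)%:E)%E.
Proof.
move=> dBC mY mZ iY iZ.
have [Y' [Z' [V [YE ZE VE mE]]]] := indep_product dBC mY mZ.
have mn U D : block_measurable D U -> block_measurable D (fun w => `|U w|).
  by move=> mU; apply: measurableT_comp => //; exact: normr_measurable.
have iYZ : P.-integrable setT (EFin \o (Y \* Z)).
  apply/integrableP; split.
    by apply/measurable_EFinP; apply: measurable_funM;
      [exact: block_measurable_fun mY|exact: block_measurable_fun mZ].
  under eq_integral => w _ do rewrite /= normrM.
  rewrite (indep_ge0_expectation dBC (mn _ _ mY) (mn _ _ mZ))//.
  by case/integrableP: iY => _ iY; case/integrableP: iZ => _ iZ;
    rewrite lte_mul_pinfty// ?integral_ge0// ge0_fin_numE ?integral_ge0.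
split=> //.
pose f (z : R * R) : \bar R := (z.1 * z.2)%:E.
have mf : measurable_fun setT f.
  apply/measurable_EFinP; apply: measurable_funM; first exact: measurable_fst.
  exact: measurable_snd.
have VwE w : V w = (Y w, Z w) by have /(congr1 (@^~ w)) := VE.
have fVE : f \o V = EFin \o (Y \* Z) by apply/funext => w; rewrite /f /= VwE.
have if_ : (distribution P Y' \x distribution P Z')%E.-integrable setT f.
  apply/integrableP; split=> //.
  rewrite (eq_measure_integral (distribution P V)); last by move=> A mA _; exact: mE.
  rewrite ge0_integral_distribution//; last exact: measurableT_comp.
  by case/integrableP: iYZ => _; rewrite -fVE.
have iU (U : {RV P >-> R}) : P.-integrable setT (EFin \o U) ->
    (distribution P U).-integrable setT (EFin : R -> \bar R).
  move=> iU; apply/integrableP; split=> //.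
  rewrite ge0_integral_distribution//; last exact: measurableT_comp.
  by case/integrableP: iU.
have EU (U : {RV P >-> R}) : P.-integrable setT (EFin \o U) ->
    (\int[distribution P U]_x x%:E = \int[P]_w (U w)%:E)%E.
  by move=> iU'; rewrite integral_distribution.
transitivity (\int[distribution P Y' \x distribution P Z']_z f z)%E.
  rewrite (eq_measure_integral (distribution P V)); last by move=> A mA _; exact: mE.
  by rewrite integral_distribution//; [rewrite fVE|rewrite fVE].
rewrite -integral12_prod_meas1//= /fubini_F /f/=.
have iY' := iU Y'; have iZ' := iU Z'; rewrite YE in iY'; rewrite ZE in iZ'.
have [c Ec] : exists c, (\int[P]_w (Z w)%:E = c%:E)%E.
  by exists (fine (\int[P]_w (Z w)%:E)); rewrite fineK//; exact: integrable_fin_num.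
under eq_integral => x _.
  under eq_integral => y _ do rewrite EFinM.
  rewrite integralZl//; last exact: iZ'.
  rewrite EU ZE// Ec.
  over.
by rewrite /= integralZr//; [rewrite EU ?YE// Ec|exact: iY'].
Qed.

Lemma indep_prod_expectation (K : eqType) (s : seq K) (B : K -> {set I})
    (Y : K -> T -> R) :
    {in s &, forall j k, j != k -> [disjoint B j & B k]%B} -> uniq s ->
    {in s, forall k, block_measurable (B k) (Y k)} ->
    (forall k w, 0 <= Y k w) ->
  (\int[P]_w (\prod_(k <- s) Y k w)%:E =
     \prod_(k <- s) \int[P]_w (Y k w)%:E)%E.
Proof.
move=> dB us mY Y0.
(* The induction also carries the measurability of the partial product over the union of its blocks,
   which splitting off one more factor requires. *)
suff : block_measurable (\bigcup_(k <- s) B k)%SET (fun w => \prod_(k <- s) Y k w) /\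
  (\int[P]_w (\prod_(k <- s) Y k w)%:E =
     \prod_(k <- s) \int[P]_w (Y k w)%:E)%E by case.
elim: s dB us mY => [|k s IH] dB /= us mY.
  split.
    rewrite (_ : (fun w => _) = (fun=> 1)); first exact: measurable_cst.
    by apply/funext => w; rewrite big_nil.
  rewrite big_nil; under eq_integral do rewrite big_nil.
  by rewrite integral_cst// mul1e; exact: probability_setT.
case/andP: us => ks us.
have [|//||mp Ep] := IH.
- by move=> i j si sj; apply: dB; rewrite inE (si, sj) orbT.
- by move=> i si; apply: mY; rewrite inE si orbT.
have mYk := mY k (mem_head _ _).
split.
  rewrite (_ : (fun w => _) = (fun w => Y k w * \prod_(j <- s) Y j w)); last first.
    by apply/funext => w; rewrite big_cons.
  apply: measurable_funM.
    by apply: block_measurableS mYk; rewrite big_cons; apply: finset.subsetUl.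
  by apply: block_measurableS mp; rewrite big_cons; apply: finset.subsetUr.
under eq_integral do rewrite big_cons.
rewrite big_cons -Ep; apply: indep_ge0_expectation mYk mp _ _ => //.
  rewrite big_seq; elim/big_rec: _ => [|j D js dD]; first by rewrite -setI_eq0 finset.setI0.
  rewrite -setI_eq0 finset.setIUr.
  move: dD; rewrite -setI_eq0 => /eqP ->; rewrite finset.setU0 setI_eq0.
  apply: dB; rewrite ?mem_head ?inE ?js ?orbT//.
  by apply: contraNneq ks => ->.
by move=> w; apply: prodr_ge0.
Qed.

End Independence.

(** * Subgaussian variables and halfline tilts *)

Section Subgaussian.
Context d (T : measurableType d) (R : realType) (P : probability T R).
Implicit Types (Y Z : T -> R) (v : R).

(** The variance equals the subgaussian parameter [v], a property that survives scaling and
    independent sums. *)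
Definition subgaussian_with_variance Y v : Prop :=
  [/\ measurable_fun setT Y, (\int[P]_w (Y w)%:E = 0)%E,
      (\int[P]_w (Y w ^+ 2)%:E = v%:E)%E &
      forall s : R,
        (\int[P]_w (expR (s * Y w))%:E <= (expR (s ^+ 2 * v / 2))%:E)%E].

Lemma measurable_expRZ Y s : measurable_fun setT Y ->
  measurable_fun setT (fun w => expR (s * Y w)).
Proof.
move=> mY; apply: measurableT_comp; first exact: measurable_expR.
exact: measurable_funM.
Qed.

Lemma strictly_subgaussian_variance1 (X : {RV P >-> R}) :
  strictly_subgaussian X -> subgaussian_with_variance X 1.
Proof.
case=> EX VX MX; split.
- exact: measurable_funPT.
- by move: EX; rewrite unlock.
- move: VX; rewrite /variance unlock EX /= unlock => <-.
  by apply: eq_integral => w _; rewrite /= fctE /= subr0 expr2.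
- move=> s; move: (MX s); rewrite mulr1 /mmt_gen_fun unlock.
  apply: le_trans; rewrite le_eqVlt; apply/orP; left; apply/eqP.
  by apply: eq_integral => w _ /=; rewrite mulrC.
Qed.

Lemma subgaussian_scale Y v a :
  subgaussian_with_variance Y v -> P.-integrable setT (EFin \o Y) ->
  subgaussian_with_variance (fun w => a * Y w) (a ^+ 2 * v).
Proof.
case=> mY EY VY MY iY; split.
- exact: measurable_funM.
- under eq_integral do rewrite EFinM.
  by rewrite integralZl// EY mule0.
- under eq_integral do rewrite exprMn EFinM.
  rewrite ge0_integralZl//; last 3 first.
  + by apply/measurable_EFinP; exact: measurable_funX.
  + by move=> w _; rewrite lee_fin sqr_ge0.
  + by rewrite lee_fin sqr_ge0.
  by rewrite VY.
- move=> s; have := MY (s * a); rewrite exprMn mulrA; apply: le_trans.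
  by rewrite le_eqVlt; apply/orP; left; apply/eqP; apply: eq_integral => w _;
    rewrite mulrA.
Qed.

Lemma subgaussian_integrable Y v :
  subgaussian_with_variance Y v -> P.-integrable setT (EFin \o Y).
Proof.
case=> mY _ VY _.
apply: (@le_integrable _ _ _ P setT measurableT _
  (EFin \o (fun w => 1 + Y w ^+ 2))).
- exact/measurable_EFinP.
- move=> w _ /=; rewrite lee_fin.
  rewrite [X in _ <= X]ger0_norm; last by rewrite addr_ge0// sqr_ge0.
  rewrite ler_norml; apply/andP; split; nra.
apply/integrableP; split.
  apply/measurable_EFinP; apply: measurable_funD => //.
  exact: measurable_funX.
under eq_integral => w _.
  rewrite /= ger0_norm; last by rewrite addr_ge0// sqr_ge0.
  rewrite EFinD; over.
rewrite ge0_integralD//; last 2 first.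
- by move=> w _; rewrite lee_fin sqr_ge0.
- by apply/measurable_EFinP; exact: measurable_funX.
rewrite VY integral_cst// mul1e.
by rewrite lte_add_pinfty ?ltry// (le_lt_trans (probability_le1 P _))// ltry.
Qed.

Lemma subgaussian_opp Y v :
  subgaussian_with_variance Y v -> subgaussian_with_variance (\- Y) v.
Proof.
move=> sY; have := subgaussian_scale (-1) sY (subgaussian_integrable sY).
rewrite sqrrN expr1n mul1r (_ : (fun w => -1 * Y w) = \- Y)//.
by apply/funext => w; rewrite mulN1r.
Qed.

Lemma integrable_sqr Y v : subgaussian_with_variance Y v ->
  P.-integrable setT (fun w => (Y w ^+ 2)%:E).
Proof.
case=> mY _ VY _; apply/integrableP; split.
  by apply/measurable_EFinP; exact: measurable_funX.
under eq_integral do rewrite abse_EFin normrX -normrX ger0_norm ?sqr_ge0//.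
by rewrite VY ltry.
Qed.

(** The fourth-order term of the exponential series; it turns exponential moments into a
    fourth-moment bound. *)
Lemma quartic_le_expR (x : R) : x ^+ 4 <= 24 * (expR x + expR (- x)).
Proof.
wlog x0 : x / 0 <= x.
  move=> H; case: (leP 0 x) => [/H//|/ltW x0].
  have := H (- x); rewrite oppr_ge0 => /(_ x0); rewrite opprK addrC.
  by rewrite (_ : (- x) ^+ 4 = x ^+ 4); last by ring.
have := @expR_ge1Dxn R x 3 x0; have := expR_gt0 (- x).
rewrite (_ : 4`!%:R = 24 :> R)//; lra.
Qed.

(* As (x + 6)^2 / 12 - 3 = x + x^2 / 12, this bounds 1_{x <= 0} e^(-bx) by
   e^(-bx) - D (x + x^2 / 12 - x^4 / 12^3): for centered x, the second moment
   yields a gain over the full exponential moment. Both sides are kept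
   nonnegative so that they can be integrated term by term. *)
Lemma halfline_tilt_le (b x : R) : 0 <= b <= 3 ->
  (x <= 0)%R%:R * expR (- b * x) + expR (- 72) / 72 * ((x + 6) ^+ 2 / 12)
  <= expR (- b * x) + expR (- 72) / 72 * (3 + x ^+ 4 / 12 ^+ 3).
Proof.
move=> /andP[b0 b3].
have [x0|x0] := leP x 0.
  rewrite mul1r lerD2l ler_pM2l; last by rewrite divr_gt0// expR_gt0.
  have y0 : 0 <= - x / 12 by lra.
  (* With x = -12 y the exponentials cancel and the claim becomes y (1 - y + y^3) >= 0. *)
  suff : 0 <= 1 - (- x / 12) + (- x / 12) ^+ 3.
    set y := - x / 12 in y0 *; have -> : x = - 12 * y by rewrite /y; field.
    nra.
  move: y0; set y := - x / 12 => y0.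
  have [y1|y1] := leP y 1; first by rewrite addr_ge0 ?exprn_ge0//; lra.
  have : y <= y ^+ 3 by rewrite -[leLHS]expr1 ler_weXn2l// ltW.
  lra.
rewrite mul0r add0r; set D := expR (- 72) / 72.
have D0 : 0 < D by rewrite divr_gt0// expR_gt0.
rewrite -lerBlDr -mulrBr.
(* Beyond 24 the quartic dominates. Up to 24, x + x^2 / 12 is at most 24 + 48 = 72 and b x at most
   72, which explains the factor e^(-72) / 72. *)
have [x24|x24] := leP x 24; last first.
  apply: le_trans (expR_ge0 _).
  apply: mulr_ge0_le0; first exact: ltW.
  set y := x / 12; have y2 : 2 <= y by rewrite /y; lra.
  have -> : x = 12 * y by rewrite /y; field.
  have y4 : y ^+ 2 * 4 <= y ^+ 4.
    rewrite (_ : 4 = 2 ^+ 2); last by ring.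
    by rewrite (exprD y 2 2) ler_pM2l ?exprn_gt0 ?ler_sqr ?nnegrE; lra.
  have -> : (12 * y) ^+ 4 / 12 ^+ 3 = 12 * y ^+ 4 by field.
  nra.
apply: (@le_trans _ _ (D * 72)).
  rewrite (ler_pM2l D0).
  have x4 : 0 <= x ^+ 4 / 12 ^+ 3.
    by apply: divr_ge0; [apply: exprn_even_ge0|apply: exprn_ge0].
  have : x * x <= 24 * 24 by nra.
  rewrite expr2; lra.
rewrite /D -mulrA mulVf; last by lra.
rewrite mulr1 ler_expR; nra.
Qed.

End Subgaussian.

(** * The gain from a halfline constraint under a tilt *)

Section SubgaussianTilt.
Context d (T : measurableType d) (R : realType) (P : probability T R).
Implicit Types (Y Z : T -> R) (v : R).

Let int_cst (c : R) : (\int[P]_w c%:E = c%:E)%E.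
Proof. by rewrite integral_cst// -[RHS]mule1; congr (_ * _)%E; exact: probability_setT. Qed.

Lemma expR_le1D2x (t : R) : 0 <= t <= 1 / 2 -> expR t <= 1 + 2 * t.
Proof.
move=> /andP[t0 t1]; have := @expR_ge1Dx R (- t); rewrite expRN => h.
have e0 := expR_gt0 t.
have : (1 - t) * expR t <= 1 by rewrite -[leRHS](mulVf (lt0r_neq0 e0)) ler_pM2r.
nra.
Qed.

(* [halfline_tilt_le] gains e^(-72) / 72 / 36 on an exponential moment
   e^(b^2 v / 2) <= e^9. *)
Definition stability_gain : R := expR (- 81) / 72 / 36.

Lemma stability_gain_gt0 : 0 < stability_gain.
Proof. by rewrite /stability_gain divr_gt0// expR_gt0. Qed.

Lemma stability_gain_le : stability_gain <= 1 / 1000.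
Proof.
have : expR (- 81) <= 1 :> R by rewrite expR_le1; lra.
rewrite /stability_gain; lra.
Qed.

Let tilt_constants_le (p q : R) : q <= p -> q / 72 / 36 <= p / 72 / 36.
Proof. lra. Qed.

(** Integration of [halfline_tilt_le]: the second moment contributes more than the bounded fourth
    moment takes away. *)
Lemma subgaussian_halfline_tilt Y v b :
  subgaussian_with_variance P Y v -> 1 <= v <= 2 -> 0 <= b <= 3 ->
  (\int[P]_w ((Y w <= 0)%R%:R * expR (- b * Y w))%:E
     <= (expR (b ^+ 2 * v / 2 - stability_gain))%:E)%E.
Proof.
move=> sY /andP[v1 v2] b03; have iY := subgaussian_integrable sY.
have iY2 := integrable_sqr sY; case: (sY) => mY EY VY MY.
have [D D0 DE] : exists2 D : R, 0 < D & expR (- 72) / 72 = D.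
  by exists (expR (- 72) / 72); rewrite // divr_gt0// expR_gt0.
have mexp s : measurable_fun setT (fun w => (expR (s * Y w))%:E).
  by apply/measurable_EFinP; exact: measurable_expRZ.
have mYX n : measurable_fun setT (fun w => (Y w ^+ n)%:E).
  by apply/measurable_EFinP; exact: measurable_funX.
have mI1 : measurable_fun setT (fun w => (Y w <= 0)%R%:R * expR (- b * Y w)).
  apply: measurable_funM; last exact: measurable_expRZ.
  rewrite (_ : (fun w => _) = \1_[set w | Y w <= 0]).
    apply: measurable_indic; rewrite -[X in measurable X]setTI.
    by apply: measurable_fun_le => //; exact: measurable_cst.
  by apply/funext => w; rewrite indicE; congr ((_ : bool)%:R); apply/idP/idP; rewrite inE.
have sq0 w : 0 <= (Y w + 6) ^+ 2 / 12 :> R by rewrite divr_ge0// sqr_ge0.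
have msq : measurable_fun setT (fun w => ((Y w + 6) ^+ 2 / 12)).
  apply: measurable_funM => //; apply: measurable_funX.
  exact: measurable_funD.
have E6 : (\int[P]_w ((Y w + 6) ^+ 2 / 12)%:E = (v / 12 + 3)%:E)%E.
  transitivity (\int[P]_w ((12^-1)%:E * (Y w ^+ 2)%:E + ((Y w)%:E + 3%:E)))%E.
    apply: eq_integral => w _; rewrite -EFinM -!EFinD; congr (_%:E); by field.
  rewrite integralD//; last 2 first.
  - exact: integrableZl.
  - apply: integrableD => //.
    apply: (@le_integrable _ _ _ P setT measurableT _ (cst 3%:E)) => //.
    by apply: finite_measure_integrable_cst.
  rewrite integralD//; last by apply: finite_measure_integrable_cst.
  by rewrite integralZl// VY EY int_cst add0e -EFinM -EFinD mulrC.
have E4 : (\int[P]_w (Y w ^+ 4)%:E <= (48 * expR (v / 2))%:E)%E.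
  apply: (@le_trans _ _ (\int[P]_w (24%:E * ((expR (1 * Y w))%:E + (expR (- 1 * Y w))%:E)))%E).
    apply: ge0_le_integral => //.
    - by move=> w _; rewrite lee_fin; apply: exprn_even_ge0.
    - apply: measurable_funeM; apply: emeasurable_funD => //; exact: mexp.
    - by move=> w _; rewrite -EFinD -EFinM lee_fin mulN1r mul1r; exact: quartic_le_expR.
  rewrite ge0_integralZl//; last 2 first.
  - by apply: emeasurable_funD => //; exact: mexp.
  - by move=> w _; rewrite adde_ge0// lee_fin expR_ge0.
  rewrite ge0_integralD//.
  have -> : 48 * expR (v / 2) = 24 * (expR (v / 2) + expR (v / 2)) by ring.
  rewrite EFinM lee_pmul2l// EFinD leeD//.
    by have := MY 1; rewrite expr1n mul1r.
  by have := MY (- 1); rewrite sqrrN expr1n mul1r.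
(* The exponent is split because [expR_le1D2x] covers only exponents up to 1/2. *)
have ev : expR (v / 2) <= 2 * v.
  have -> : v / 2 = 1 / 2 + (v - 1) / 2 by field.
  have h1 : expR (1 / 2) <= 1 + 2 * (1 / 2) :> R by apply: expR_le1D2x; lra.
  have h2 : expR ((v - 1) / 2) <= 1 + 2 * ((v - 1) / 2) by apply: expR_le1D2x; lra.
  by rewrite expRD (le_trans (ler_pM (expR_ge0 _) (expR_ge0 _) h1 h2))//; lra.
have [k k0 kE] : exists2 k : R, 0 < k & 12 ^+ 3 = k^-1.
  by exists (12 ^- 3); rewrite ?invrK// invr_gt0 exprn_gt0.
pose f1 w : \bar R := ((Y w <= 0)%R%:R * expR (- b * Y w))%:E.
pose f2 w : \bar R := ((Y w + 6) ^+ 2 / 12)%:E.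
pose g1 w : \bar R := (expR (- b * Y w))%:E.
pose g2 w : \bar R := (Y w ^+ 4)%:E.
have f1_ge0 w : setT w -> (0 <= f1 w)%E by move=> _; rewrite lee_fin mulr_ge0// expR_ge0.
have f2_ge0 w : setT w -> (0 <= f2 w)%E by rewrite lee_fin.
have g1_ge0 w : setT w -> (0 <= g1 w)%E by rewrite lee_fin expR_ge0.
have g2_ge0 w : setT w -> (0 <= g2 w)%E by rewrite lee_fin exprn_even_ge0.
have mf1 : measurable_fun setT f1 by exact/measurable_EFinP.
have mf2 : measurable_fun setT f2 by exact/measurable_EFinP.
have mg1 : measurable_fun setT g1 by exact: mexp.
have mg2 : measurable_fun setT g2 by exact: mYX.
have De0 : (0 <= D%:E)%E by rewrite lee_fin ltW.
have ke0 : (0 <= k%:E)%E by rewrite lee_fin ltW.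
have three0 (w : T) : setT w -> (0 <= cst (3%:E : \bar R) w)%E by move=> _; rewrite lee_fin.
have mDf2 : measurable_fun setT (fun w => D%:E * f2 w)%E by exact: measurable_funeM.
have Df2_ge0 w : setT w -> (0 <= D%:E * f2 w)%E by move=> Tw; rewrite mule_ge0// f2_ge0.
have mkg2 : measurable_fun setT (fun w => k%:E * g2 w)%E by exact: measurable_funeM.
have kg2_ge0 w : setT w -> (0 <= k%:E * g2 w)%E by move=> Tw; rewrite mule_ge0// g2_ge0.
have m3 : measurable_fun setT (fun w => 3%:E + k%:E * g2 w)%E by exact: emeasurable_funD.
have h3_ge0 w : setT w -> (0 <= 3%:E + k%:E * g2 w)%E.
  by move=> Tw; rewrite adde_ge0// kg2_ge0.
have mD3 : measurable_fun setT (fun w => D%:E * (3%:E + k%:E * g2 w))%E.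
  exact: measurable_funeM.
have D3_ge0 w : setT w -> (0 <= D%:E * (3%:E + k%:E * g2 w))%E.
  by move=> Tw; rewrite mule_ge0// h3_ge0.
have main : ((\int[P]_w f1 w) + (D * (v / 12 + 3))%:E <=
   (expR (b ^+ 2 * v / 2))%:E + (D * (3 + k * (48 * expR (v / 2))))%:E)%E.
  rewrite EFinM -E6 -(ge0_integralZl P measurableT mf2 f2_ge0 De0).
  rewrite -(ge0_integralD P measurableT f1_ge0 mf1 Df2_ge0 mDf2).
  apply: (@le_trans _ _ (\int[P]_w (g1 w + D%:E * (3%:E + k%:E * g2 w)))%E).
    apply: ge0_le_integral => //.
    - by move=> w Tw; rewrite adde_ge0// ?f1_ge0// Df2_ge0.
    - exact: emeasurable_funD.
    - exact: emeasurable_funD.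
    - move=> w _; have := halfline_tilt_le (Y w) b03.
      by rewrite DE kE invrK [_ ^+ 4 * k]mulrC -lee_fin.
  rewrite (ge0_integralD P measurableT g1_ge0 mg1 D3_ge0 mD3) leeD//.
    by have := MY (- b); rewrite sqrrN.
  rewrite (ge0_integralZl P measurableT m3 h3_ge0 De0) EFinM lee_pmul2l ?lte_fin//.
  rewrite (ge0_integralD P measurableT three0 _ kg2_ge0 mkg2)//.
  rewrite int_cst [X in (_ <= X)%E]EFinD leeD2l//.
  by rewrite (ge0_integralZl P measurableT mg2 g2_ge0 ke0) EFinM lee_pmul2l// lte_fin.
have fin1 : (\int[P]_w f1 w)%E \is a fin_num.
  rewrite ge0_fin_numE ?integral_ge0//.
  apply: le_lt_trans (_ : _ <= (expR (b ^+ 2 * v / 2))%:E)%E (ltry _).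
  apply: le_trans (_ : _ <= \int[P]_w g1 w)%E _.
    apply: ge0_le_integral => // w _; rewrite lee_fin.
    by case: (Y w <= 0); rewrite ?mul1r// mul0r expR_ge0.
  by have := MY (- b); rewrite sqrrN.
move: main; rewrite -/f1 -(fineK fin1) -!EFinD !lee_fin.
set A := fine _ => main.
have kv : k * 1728 = 1 by rewrite -[k]invrK -kE; field.
(* The fourth moment costs at most 48 v / 864 = v / 18, leaving v / 12 - v / 18 = v / 36 >= 1 /
   36. *)
have gain : A <= expR (b ^+ 2 * v / 2) - D / 36.
  have : k * expR (v / 2) <= k * (2 * v) by rewrite ler_pM2l.
  have kv' : 1728 * (k * v) = v by transitivity (k * 1728 * v); [ring|rewrite kv mul1r].
  set K := k * expR (v / 2).
  rewrite (_ : k * (48 * expR (v / 2)) = 48 * K) in main; last by rewrite /K; ring.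
  have -> : k * (2 * v) = 2 * (k * v) by ring.
  move=> hK; have {hK kv'} hK : K <= v / 864 by move: kv' hK; set kv2 := k * v; lra.
  have : D * (48 * K) <= D * (48 * (v / 864)) by rewrite (ler_pM2l D0); lra.
  have : D * 1 <= D * v by rewrite ler_pM2l.
  move: main; lra.
apply: le_trans gain _.
(* The additive gain becomes a factor: since e <= e^9, D / 36 is at least e times [stability_gain],
   and 1 - r <= e^(-r). *)
have bv : b ^+ 2 * v / 2 <= 9 by case/andP: b03 => b0 b3; rewrite expr2; nra.
set e := expR (b ^+ 2 * v / 2).
have e9 : e <= expR 9 by rewrite ler_expR.
have E81 : expR (- 81) * e <= expR (- 72).
  apply: (@le_trans _ _ (expR (- 81) * expR 9)).
    by rewrite ler_pM2l// expR_gt0.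
  by rewrite -expRD ler_expR; lra.
rewrite /stability_gain expRD -/e.
have := @expR_ge1Dx R (- (expR (- 81) / 72 / 36)); set r := expR (- (_ / _ / _)) => hr.
have e0 : 0 < e := expR_gt0 _.
apply: (@le_trans _ _ (e * (1 - expR (- 81) / 72 / 36))); last by rewrite ler_pM2l.
rewrite -DE mulrBr mulr1 lerD2l lerN2 !mulrA; rewrite mulrC in E81.
exact: tilt_constants_le E81.
Qed.

End SubgaussianTilt.

(** * Sums of independent subgaussian variables and constrained blocks *)

Section IndependentSubgaussian.
Context d (T : measurableType d) (R : realType) (P : probability T R).
Context (I : finType) (X : I -> {RV P >-> R}).
Hypothesis indepX : mutually_independent X.
Hypothesis sgX : forall i, subgaussian_with_variance P (X i) 1.
Implicit Types (B C : {set I}) (a : I -> R).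

Lemma block_measurable_sum B a :
  block_measurable X B (fun w => \sum_(i in B) a i * X i w).
Proof.
rewrite /block_measurable (_ : (fun w => _) =
    (fun w => \sum_(i <- enum B) a i * X i w)); last first.
  by apply/funext => w; rewrite big_enum.
have : {subset enum B <= B} by move=> i; rewrite mem_enum.
elim: (enum B) => [|i s IH] sB.
  rewrite (_ : (fun w => _) = (fun=> 0)); first exact: measurable_cst.
  by apply/funext => w; rewrite big_nil.
rewrite (_ : (fun w => _) = (fun w => a i * X i w + \sum_(j <- s) a j * X j w)).
  apply: measurable_funD.
    by apply: measurable_funM => //; apply: block_measurable_RV; rewrite sB ?mem_head.
  by apply: IH => j js; rewrite sB// inE js orbT.
by apply/funext => w; rewrite big_cons.
Qed.

Lemma lee_prod (J : Type) (s : seq J) (p : pred J) (f g : J -> \bar R) :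
  (forall j, p j -> 0 <= f j)%E -> (forall j, p j -> f j <= g j)%E ->
  (\prod_(j <- s | p j) f j <= \prod_(j <- s | p j) g j)%E.
Proof.
move=> f0 fg.
suff : (0 <= \prod_(j <- s | p j) f j /\
        \prod_(j <- s | p j) f j <= \prod_(j <- s | p j) g j)%E by case.
elim/big_rec2 : _ => [|j x y pj [x0 xy]]; first by split=> //; rewrite lee_fin.
by split; [apply: mule_ge0 => //; exact: f0|apply: lee_pmul => //; [exact: f0|exact: fg]].
Qed.

Lemma subgaussian_mgf_sum B a :
  (\int[P]_w (expR (\sum_(i in B) a i * X i w))%:E <=
     (expR ((\sum_(i in B) a i ^+ 2) / 2))%:E)%E.
Proof.
under eq_integral => w _ do rewrite expR_sum -big_enum.
rewrite (@indep_prod_expectation _ _ _ _ _ _ indepX _ _ (fun i => [set i]%SET)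
  (fun i w => expR (a i * X i w))).
- rewrite mulr_suml expR_sum -big_enum -prodEFin.
  apply: lee_prod => i _.
    by apply: integral_ge0 => w _; rewrite lee_fin expR_ge0.
  by case: (sgX i) => _ _ _ /(_ (a i)); rewrite mulr1.
- move=> i j _ _ ij; rewrite disjoints1 inE//.
- exact: enum_uniq.
- move=> i _; apply: measurableT_comp; first exact: measurable_expR.
  by apply: measurable_funM => //; apply: block_measurable_RV; rewrite inE.
- by move=> i w; rewrite expR_ge0.
Qed.

Lemma subgaussian_sum B :
  subgaussian_with_variance P (fun w => \sum_(i in B) X i w) #|B|%:R.
Proof.
have iX i : P.-integrable setT (EFin \o X i) := subgaussian_integrable (sgX i).
have iX2 i : P.-integrable setT (fun w => (X i w ^+ 2)%:E) := integrable_sqr (sgX i).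
have pX C : block_measurable X C (fun w => \sum_(i in C) X i w).
  rewrite (_ : (fun w => _) = (fun w => \sum_(i in C) 1 * X i w)).
    exact: block_measurable_sum.
  by apply/funext => w; apply: eq_bigr => i _; rewrite mul1r.
(* Only the first two moments need induction. Integrability is added to the claim so that the
   expanded square can be integrated term by term; its cross term vanishes by independence. *)
suff [iS ES iS2 VS] : [/\ P.-integrable setT (fun w => (\sum_(i in B) X i w)%:E),
   (\int[P]_w (\sum_(i in B) X i w)%:E = 0)%E,
   P.-integrable setT (fun w => ((\sum_(i in B) X i w) ^+ 2)%:E) &
   (\int[P]_w ((\sum_(i in B) X i w) ^+ 2)%:E = #|B|%:R%:E)%E].
  split=> //.
    exact: block_measurable_fun (pX B).
  move=> s; have := subgaussian_mgf_sum B (fun=> s).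
  rewrite sumr_const mulr_natr; apply: le_trans.
  rewrite le_eqVlt; apply/orP; left; apply/eqP.
  by apply: eq_integral => w _; rewrite mulr_sumr.
have [n] := ubnP #|B|; elim: n B => // n IH B.
have [->|[i iB]] := set_0Vmem B.
  have S0 w : \sum_(i in finset.set0) X i w = 0 by rewrite big_set0.
  rewrite cards0 /= => _.
  split.
  - rewrite (_ : (fun w => _) = cst 0%E); first exact: integrable0.
    by apply/funext => w; rewrite S0.
  - by rewrite integral0_eq// => w _; rewrite S0.
  - rewrite (_ : (fun w => _) = cst 0%E); first exact: integrable0.
    by apply/funext => w; rewrite S0 expr0n.
  - by rewrite integral0_eq// => w _; rewrite S0 expr0n.
rewrite (cardsD1 i) iB add1n !ltnS => /IH[iS ES iS2 VS].
set C := (B :\ i)%SET in iS ES iS2 VS *.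
have SE w : \sum_(j in B) X j w = X i w + \sum_(j in C) X j w by rewrite (big_setD1 i).
have dis : [disjoint [set i]%SET & C]%B by rewrite disjoints1 !inE eqxx.
have Xi : block_measurable X [set i]%SET (X i) by apply: block_measurable_RV; rewrite inE.
have [iXS EXS] := indep_expectation indepX dis Xi (pX C) (iX i) iS.
have iXi : P.-integrable setT (fun w => (X i w)%:E) := iX i.
have iXi2 := iX2 i.
have {}iXS : P.-integrable setT (fun w => (X i w * \sum_(j in C) X j w)%:E) := iXS.
have iXS2 : P.-integrable setT
    (fun w => (2%:E * (X i w * \sum_(j in C) X j w)%:E)%E) by exact: integrableZl.
have iXS2S : P.-integrable setT (fun w => (2%:E * (X i w * \sum_(j in C) X j w)%:E
   + ((\sum_(j in C) X j w) ^+ 2)%:E)%E) by exact: integrableD.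
case: (sgX i) => _ EXi VXi _.
split.
- rewrite (_ : (fun w => _) =
      (fun w => (X i w)%:E + (\sum_(j in C) X j w)%:E)%E).
    exact: integrableD.
  by apply/funext => w; rewrite SE EFinD.
- under eq_integral do rewrite SE EFinD.
  by rewrite integralD// EXi ES adde0.
- rewrite (_ : (fun w => _) = (fun w => (X i w ^+ 2)%:E +
     (2%:E * (X i w * \sum_(j in C) X j w)%:E + ((\sum_(j in C) X j w) ^+ 2)%:E))%E).
    exact: integrableD.
  by apply/funext => w; rewrite SE -EFinM -!EFinD; congr (_%:E); ring.
- transitivity (\int[P]_w ((X i w ^+ 2)%:E +
     (2%:E * (X i w * \sum_(j in C) X j w)%:E + ((\sum_(j in C) X j w) ^+ 2)%:E)))%E.
    by apply: eq_integral => w _; rewrite SE -EFinM -!EFinD; congr (_%:E); ring.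
  rewrite integralD// integralD//.
  by rewrite integralZl// EXS EXi mul0e mule0 add0e VXi VS -EFinD -natr1 addrC.
Qed.

(** Constant weights on a block make its contribution a tilt of the single variable t times the
    block sum, of variance t^2 |B k|. The blocks are independent, so each constrained one gains
    separately. *)
Lemma blocks_tilt (K : finType) (s : {set K}) (B : K -> {set I}) a (b t : R) :
    (forall j k, j != k -> [disjoint B j & B k]%B) ->
    (forall k, k \notin s -> B k = finset.set0) ->
    0 < t -> 0 <= b <= 3 ->
    (forall k, k \in s -> 1 <= t ^+ 2 * #|B k|%:R <= 2) ->
    (forall k i, i \in B k -> a i = - (b * t)) ->
  (\int[P]_w (expR (\sum_i a i * X i w) *
       \prod_(k in s) (\sum_(i in B k) X i w <= 0)%R%:R)%:E
    <= (expR ((\sum_i a i ^+ 2) / 2 - stability_gain R * #|s|%:R))%:E)%E.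
Proof.
move=> dB B0 t0 b03 Bs aB.
pose D := (~: \bigcup_k B k)%SET.
have sumE (f : I -> R) : \sum_i f i = \sum_(i in D) f i + \sum_(k in s) \sum_(i in B k) f i.
  rewrite (bigID (mem D))/=; congr (_ + _).
  rewrite (eq_bigl (mem (\bigcup_k B k)%SET)); last by move=> i; rewrite !inE negbK.
  rewrite partition_disjoint_bigcup// (bigID (mem s))/= [X in _ + X]big1 ?addr0//.
  by move=> k ks; rewrite B0// big_set0.
pose Z k w := t * \sum_(i in B k) X i w.
pose h (x : R) : R := (x <= 0)%R%:R * expR (- b * x).
(* [None] indexes the entries outside all blocks, which carry no constraint. *)
pose Y (k : option K) w := if k is Some k then h (Z k w)
  else expR (\sum_(i in D) a i * X i w).
pose B' (k : option K) := if k is Some k then B k else D.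
have YE w : expR (\sum_i a i * X i w) *
    \prod_(k in s) (\sum_(i in B k) X i w <= 0)%R%:R =
    \prod_(k <- None :: [seq Some k | k <- enum s]) Y k w.
  rewrite big_cons big_map big_enum/= sumE expRD -mulrA; congr (_ * _).
  rewrite expR_sum -big_split/=; apply: eq_bigr => k ks.
  rewrite /h /Z mulrC; congr (_ * expR _).
    by rewrite pmulr_rle0.
  rewrite mulrA mulr_sumr; apply: eq_bigr => i iB.
  by rewrite (aB k i iB) !mulNr.
have dBD k : [disjoint B k & D]%B.
  by rewrite finset.disjoints_subset /D finset.setCK; apply: finset.bigcup_sup.
have mh : measurable_fun setT h.
  apply: measurable_funM; last exact: measurable_expRZ.
  rewrite (_ : (fun w => _) = \1_[set x : R | x <= 0]).
    apply: measurable_indic; rewrite -[X in measurable X]setTI.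
    by apply: measurable_fun_le => //; exact: measurable_cst.
  by apply/funext => w; rewrite indicE; congr ((_ : bool)%:R); apply/idP/idP; rewrite inE.
have h0 x : 0 <= h x by rewrite mulr_ge0// expR_ge0.
under eq_integral => w _ do rewrite YE.
rewrite (@indep_prod_expectation _ _ _ _ _ _ indepX _ _ B' Y).
- rewrite big_cons big_map big_enum/= sumE mulrDl -addrA expRD EFinM.
  apply: lee_pmul.
  + by apply: integral_ge0 => w _; rewrite lee_fin expR_ge0.
  + by apply: prode_ge0 => k _; apply: integral_ge0 => w _; rewrite lee_fin.
  + exact: subgaussian_mgf_sum.
  rewrite -mulr_natr -sumr_const mulr_sumr mulr_suml -sumrB expR_sum -prodEFin.
  apply: lee_prod => k ks.
    by apply: integral_ge0 => w _; rewrite lee_fin.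
  have sB := subgaussian_sum (B k).
  have sZ := subgaussian_scale t sB (subgaussian_integrable sB).
  apply: le_trans (subgaussian_halfline_tilt sZ (Bs k ks) b03) _.
  rewrite lee_fin ler_expR mulr1 lerD2r.
  rewrite (eq_bigr (fun=> (b * t) ^+ 2)); last by move=> i iB; rewrite (aB k i iB) sqrrN.
  rewrite sumr_const -[_ *+ _]mulr_natr exprMn; lra.
- move=> [j|] [k|] _ _ jk//=.
  + exact: dB.
  + by rewrite disjoint_sym; exact: dBD.
- by rewrite /= map_inj_uniq ?enum_uniq ?andbT; [apply/mapP => -[]|move=> ? ? []].
- move=> [k|] _ /=; last first.
    by apply: measurableT_comp; [exact: measurable_expR|exact: block_measurable_sum].
  apply: measurableT_comp => //; apply: measurable_funM => //.
  rewrite (_ : (fun w => _) = (fun w => \sum_(i in B k) 1 * X i w)).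
    exact: block_measurable_sum.
  by apply/funext => w; apply: eq_bigr => i _; rewrite mul1r.
- by move=> [k|] w; rewrite ?expR_ge0 ?h0.
Qed.
End IndependentSubgaussian.

(** * The union bound *)

Section SquareBlocks.
Context (N : nat).
Implicit Types (U : {set 'I_N}) (i j : 'I_N) (p : 'I_N * 'I_N).

Definition square U : {set 'I_N * 'I_N} := finset.setX U U.

(** For an empty site [i], the entries whose sum is the variable G_i: row and column of [i] over
    [U], with the diagonal entry. *)
Definition flip_block U i : {set 'I_N * 'I_N} := (square (i |: U) :\: square U)%SET.

Lemma in_square U p : (p \in square U) = (p.1 \in U) && (p.2 \in U).
Proof. by rewrite inE. Qed.

Lemma squareS U i : square U \subset square (i |: U)%SET.
Proof.
apply/fintype.subsetP => p; rewrite !in_square => /andP[h1 h2].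
by rewrite !inE h1 h2 !orbT.
Qed.

Lemma card_square U : #|square U| = (#|U| ^ 2)%N.
Proof. by rewrite finset.cardsX expnS expn1. Qed.

Lemma flip_block_mem0 U i : i \in U -> flip_block U i = finset.set0.
Proof.
by move=> iU; rewrite /flip_block (finset.setUidPr _) ?finset.setDv// finset.sub1set.
Qed.

Lemma card_flip_block U i : i \notin U -> #|flip_block U i| = #|U|.*2.+1.
Proof.
move=> iU; rewrite cardsD (finset.setIidPr (squareS U i)) !card_square cardsU1 iU.
by rewrite -mul2n; lia.
Qed.

(** Both coordinates of a common entry would lie in [U], hence the entry in the removed square. *)
Lemma flip_block_disjoint U i j :
  i != j -> [disjoint flip_block U i & flip_block U j]%B.
Proof.
move=> ij; apply/pred0P => -[a b] /=; apply/negbTE/negP.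
rewrite !inE /= => /andP[/andP[aU /andP[ai bi]] /andP[_ /andP[aj bj]]].
have H c : (c == i) || (c \in U) -> (c == j) || (c \in U) -> c \in U.
  by move=> /orP[/eqP->|//] /orP[|//]; rewrite (negbTE ij).
by move: aU; rewrite (H a)// (H b).
Qed.

Lemma flip_block_notin U i p : p \in flip_block U i -> p \notin square U.
Proof. by rewrite inE => /andP[]. Qed.

Lemma sum_squareU (R : zmodType) U i (f : 'I_N * 'I_N -> R) :
  \sum_(p in square (i |: U)%SET) f p =
  \sum_(p in square U) f p + \sum_(p in flip_block U i) f p.
Proof. by rewrite (big_setID (square U))/= (finset.setIidPr (squareS U i)). Qed.

End SquareBlocks.

(** * Exponential moments of the tilted energy *)

Section SquareTilt.
Context d (T : measurableType d) (R : realType) (P : probability T R).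
Context (N : nat) (X : 'I_N * 'I_N -> {RV P >-> R}).
Hypothesis indepX : mutually_independent X.
Hypothesis sgX : forall p, subgaussian_with_variance P (X p) 1.
Hypothesis N0 : (0 < N)%N.
Implicit Types (U : {set 'I_N}) (lam b : R).

Let NR : R := N%:R.
Let NR0 : 0 < NR. Proof. by rewrite ltr0n. Qed.
Let t : R := (Num.sqrt NR)^-1.
Let t0 : 0 < t. Proof. by rewrite invr_gt0 sqrtr_gt0. Qed.
Let t2 : t ^+ 2 = NR^-1. Proof. by rewrite exprVn sqr_sqrtr// ltW. Qed.

Definition density U : R := #|U|%:R / NR.

(* The weights of lam (H(U) - a^2 S), where S is the sum of all entries over
   sqrt N and a the density of U: H(U) - a^2 S is orthogonal to S, which lowers
   its variance from N a^2 to N a^2 (1 - a^2). *)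
Definition tilt U lam p : R := lam * t * ((p \in square U)%:R - density U ^+ 2).

(** A fraction a^2 of the N^2 entries lies in the square, so the centered indicator has the
    Bernoulli variance a^2 (1 - a^2). *)
Lemma sum_tilt_sqr U lam :
  \sum_p tilt U lam p ^+ 2 = lam ^+ 2 * NR * (density U ^+ 2 * (1 - density U ^+ 2)).
Proof.
set a := density U.
have E p : tilt U lam p ^+ 2 =
    lam ^+ 2 * NR^-1 * ((1 - 2 * a ^+ 2) * (p \in square U)%:R + a ^+ 4).
  rewrite /tilt -/a -t2; case: (p \in square U) => /=; ring.
under eq_bigr => p _ do rewrite E.
rewrite -mulr_sumr big_split/= -mulr_sumr -natr_sum.
rewrite -(big_mkcond (fun p => p \in square U) (fun=> 1%N))/= sum1_card card_square.
rewrite sumr_const card_prod card_ord.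
have kE : #|U|%:R = a * NR by rewrite /a /density divfK// gt_eqF.
rewrite -[a ^+ 4 *+ _]mulr_natr natrX natrM kE -/NR.
by field; rewrite gt_eqF.
Qed.

Lemma tilt_mgf U lam :
  (\int[P]_w (expR (\sum_p tilt U lam p * X p w))%:E <=
   (expR (lam ^+ 2 * NR * (density U ^+ 2 * (1 - density U ^+ 2)) / 2))%:E)%E.
Proof.
have := subgaussian_mgf_sum indepX sgX finset.setT (tilt U lam).
rewrite (eq_bigl xpredT) => [|p]; last by rewrite inE.
rewrite sum_tilt_sqr; apply: le_trans; rewrite le_eqVlt; apply/orP; left; apply/eqP.
by apply: eq_integral => w _; congr (expR _)%:E; apply: eq_bigl => p; rewrite inE.
Qed.

(** Flip blocks lie outside the square, where the weight is the constant -lam t a^2, so b = lam a^2.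
    The scaled block variance is 2 a + 1 / N, which lies in [1, 2] for these densities and N >=
    5. *)
Lemma tilt_stable_mgf U lam : (5 <= N)%N ->
  1 / 2 <= density U <= 9 / 10 -> 0 <= lam * density U ^+ 2 <= 3 ->
  (\int[P]_w (expR (\sum_p tilt U lam p * X p w) *
       \prod_(i in ~: U) (\sum_(p in flip_block U i) X p w <= 0)%R%:R)%:E <=
   (expR (lam ^+ 2 * NR * (density U ^+ 2 * (1 - density U ^+ 2)) / 2
          - stability_gain R * #|(~: U)%SET|%:R))%:E)%E.
Proof.
move=> N5 aU lamU.
rewrite -sum_tilt_sqr.
apply: (@blocks_tilt _ _ _ _ _ X indepX sgX _ _ (flip_block U) (tilt U lam)
  (lam * density U ^+ 2) t) => //.
- exact: flip_block_disjoint.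
- by move=> i; rewrite inE negbK => /flip_block_mem0.
- move=> i; rewrite inE => iU; rewrite t2 card_flip_block// -muln2 -addn1 natrD natrM.
  have kE : #|U|%:R = density U * NR by rewrite /density divfK// gt_eqF.
  have NR5 : 5 <= NR by rewrite ler_nat.
  by rewrite kE [NR^-1 * _]mulrC ler_pdivlMr// ler_pdivrMr// ; nra.
- move=> i p /flip_block_notin/negbTE pU.
  by rewrite /tilt pU mulr0n sub0r; ring.
Qed.

End SquareTilt.

(** * Entropy bounds for the number of configurations *)

Section Counting.
Context {R : realType} (N : nat).

Lemma sum_over_card (f : nat -> R) :
  \sum_(U : {set 'I_N}) f #|U| = \sum_(k < N.+1) 'C(N, k)%:R * f k.
Proof.
have cardU (U : {set 'I_N}) : (#|U| < N.+1)%N by rewrite ltnS -[X in (_ <= X)%N]card_ord max_card.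
rewrite (partition_big (fun U : {set 'I_N} => Ordinal (cardU U)) xpredT)//=.
apply: eq_bigr => k _; rewrite (eq_bigr (fun=> f k)); last by move=> U /eqP <-.
rewrite sumr_const -[LHS]mulr_natl; congr (_%:R * _).
have := card_draws 'I_N k; rewrite card_ord => <-.
by apply: eq_card => U; rewrite !inE.
Qed.

(** The left side is one term of the binomial expansion of ((1 - a) + a)^N = 1 with a = k / N. *)
Lemma bin_entropy_le1 (k : nat) : (0 < k < N)%N ->
  'C(N, k)%:R * expR (- (N%:R * entropy (k%:R / N%:R))) <= 1 :> R.
Proof.
move=> /andP[k0 kN].
have N0 : 0 < N%:R :> R by rewrite ltr0n (leq_trans _ kN).
set a : R := k%:R / N%:R.
have a0 : 0 < a by rewrite divr_gt0// ltr0n.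
have a1 : 0 < 1 - a by rewrite subr_gt0 ltr_pdivrMr// mul1r ltr_nat.
have aN : a * N%:R = k%:R by rewrite divfK// gt_eqF.
have -> : expR (- (N%:R * entropy a)) = (1 - a) ^+ (N - k) * a ^+ k.
  rewrite -[in RHS](lnK a1) -[X in _ * X ^+ k](lnK a0) -!expRM_natl -expRD; congr expR.
  by rewrite natrB ?(ltnW kN)// -aN /entropy; ring.
have := exprDn (1 - a) a N; rewrite subrK expr1n => E; rewrite [leRHS]E {E}.
rewrite (bigD1 (Ordinal (ltnW kN : (k < N.+1)%N)))//= mulr_natl lerDl.
apply: sumr_ge0 => i _; apply: mulrn_wge0.
by rewrite mulr_ge0 ?exprn_ge0// ltW.
Qed.

Lemma expR_ge2 : 2 <= expR (75 / 100) :> R.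
Proof.
have -> : 75 / 100 = 75 / 800 * 8%:R :> R by field.
rewrite expRM_natr.
have h : 1 + 75 / 800 <= expR (75 / 800) :> R by exact: expR_ge1Dx.
apply: (@le_trans _ _ ((1 + 75 / 800) ^+ 8)); first by lra.
by rewrite lerXn2r// nnegrE; lra.
Qed.

Lemma sum_sets_expR :
  \sum_(U : {set 'I_N}) expR (- (79 / 100) * N%:R) <= expR (- (4 / 100) * N%:R) :> R.
Proof.
rewrite sumr_const -[X in expR _ *+ X]cardsT -powersetT card_powerset cardsT card_ord.
rewrite -[leLHS]mulr_natl natrX.
apply: (@le_trans _ _ (expR (75 / 100) ^+ N * expR (- (79 / 100) * N%:R))).
  by rewrite ler_pM2r ?expR_gt0// lerXn2r// ?nnegrE ?expR_ge0// expR_ge2.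
rewrite -expRM_natr -expRD ler_expR; lra.
Qed.

End Counting.

(** * The expected weight of one configuration *)

Section UnionBound.
Context d (T : measurableType d) (R : realType) (P : probability T R).
Context (N : nat) (X : 'I_N * 'I_N -> {RV P >-> R}).
Hypothesis indepX : mutually_independent X.
Hypothesis sgX : forall p, subgaussian_with_variance P (X p) 1.
Hypothesis N5 : (5 <= N)%N.
Implicit Types (U : {set 'I_N}) (lam b m eps : R) (w : T).

Let NR : R := N%:R.
Let NR0 : 0 < NR. Proof. by rewrite ltr0n (leq_trans _ N5). Qed.
Let t : R := (Num.sqrt NR)^-1.
Let t0 : 0 < t. Proof. by rewrite invr_gt0 sqrtr_gt0. Qed.
Let t2 : t ^+ 2 = NR^-1. Proof. by rewrite exprVn sqr_sqrtr// ltW. Qed.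

Definition set_energy U w : R := t * \sum_(p in square U) X p w.
Definition total_energy w : R := t * \sum_p X p w.

(** A real-valued 0-1 indicator that occupying one more site does not increase the energy. *)
Definition flip_stable U w : R :=
  \prod_(i in ~: U) (\sum_(p in flip_block U i) X p w <= 0)%R%:R.

Lemma tilt_sumE U lam w : \sum_p tilt U lam p * X p w =
  lam * (set_energy U w - density R U ^+ 2 * total_energy w).
Proof.
have E p : tilt U lam p * X p w =
    lam * t * ((p \in square U)%:R * X p w - density R U ^+ 2 * X p w).
  by rewrite /tilt -/t; ring.
under eq_bigr do rewrite E.
rewrite -mulr_sumr sumrB -mulr_sumr.
have -> : \sum_p (p \in square U)%:R * X p w = \sum_(p in square U) X p w.
  rewrite [RHS]big_mkcond; apply: eq_bigr => p _.
  by case: ifP; rewrite ?mul1r ?mul0r.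
rewrite /set_energy /total_energy; ring.
Qed.

Lemma integral_expRB (f g : T -> R) (c b : R) :
  measurable_fun setT f -> measurable_fun setT g -> (forall w, 0 <= g w) ->
  (\int[P]_w (expR (f w) * g w)%:E <= (expR b)%:E)%E ->
  (\int[P]_w (expR (f w - c) * g w)%:E <= (expR (b - c))%:E)%E.
Proof.
move=> mf mg g0 fb.
under eq_integral => w _ do rewrite expRD mulrAC mulrC EFinM.
rewrite ge0_integralZl//.
- by rewrite expRD mulrC EFinM lee_pmul2l// lte_fin expR_gt0.
- apply/measurable_EFinP; apply: measurable_funM => //.
  by apply: measurableT_comp => //; exact: measurable_expR.
- by move=> w _; rewrite lee_fin mulr_ge0// expR_ge0.
Qed.

Lemma measurable_sumX (A : {set 'I_N * 'I_N}) (a : 'I_N * 'I_N -> R) :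
  measurable_fun setT (fun w => \sum_(p in A) a p * X p w).
Proof.
by apply: (@block_measurable_fun _ _ _ _ _ X A); exact: block_measurable_sum.
Qed.

Lemma measurable_total_energy : measurable_fun setT total_energy.
Proof.
apply: measurable_funM => //.
rewrite (_ : (fun w => _) = (fun w => \sum_(p in [set: 'I_N * 'I_N]%SET) 1 * X p w)).
  exact: measurable_sumX.
by apply/funext => w; apply: eq_big => p; rewrite ?inE ?mul1r.
Qed.

Lemma measurable_set_energy U : measurable_fun setT (set_energy U).
Proof.
apply: measurable_funM => //.
rewrite (_ : (fun w => _) = (fun w => \sum_(p in square U) 1 * X p w)).
  exact: measurable_sumX.
by apply/funext => w; apply: eq_bigr => p _; rewrite ?mul1r.
Qed.

Lemma measurable_tilt_sum U lam :
  measurable_fun setT (fun w => \sum_p tilt U lam p * X p w).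
Proof.
under eq_fun do rewrite tilt_sumE.
apply: measurable_funM => //; apply: measurable_funB.
  exact: measurable_set_energy.
by apply: measurable_funM => //; exact: measurable_total_energy.
Qed.

Lemma flip_stable_ge0 U w : 0 <= flip_stable U w.
Proof. by apply: prodr_ge0. Qed.

Lemma measurable_flip_stable U : measurable_fun setT (flip_stable U).
Proof.
rewrite (_ : flip_stable U = (fun w => \prod_(i <- enum (~: U)%SET)
    (\sum_(p in flip_block U i) X p w <= 0)%R%:R)); last first.
  by apply/funext => w; rewrite /flip_stable -big_enum.
elim: (enum _) => [|i s IH].
  rewrite (_ : (fun w => _) = (fun=> 1)); first exact: measurable_cst.
  by apply/funext => w; rewrite big_nil.
rewrite (_ : (fun w => _) = (fun w =>
    (\sum_(p in flip_block U i) X p w <= 0)%R%:R *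
    \prod_(j <- s) (\sum_(p in flip_block U j) X p w <= 0)%R%:R)); last first.
  by apply/funext => w; rewrite big_cons.
apply: measurable_funM => //.
rewrite (_ : (fun w => _) = \1_[set w | \sum_(p in flip_block U i) 1 * X p w <= 0]).
  apply: measurable_indic; rewrite -[X in measurable X]setTI.
  by apply: measurable_fun_le => //; exact: measurable_sumX.
apply/funext => w; rewrite indicE; congr ((_ : bool)%:R).
have E : \sum_(p in flip_block U i) 1 * X p w = \sum_(p in flip_block U i) X p w.
  by apply: eq_bigr => p _; rewrite mul1r.
by apply/idP/idP; rewrite inE/= E.
Qed.

Definition mid_density U : bool := 1 / 2 <= density R U <= 9 / 10.

(* For intermediate densities, the optimal Chernoff parameter. Elsewhere
   a^2 (1 - a^2) <= 3 / 16 and the parameter optimal for 3 / 16 beats 2^N. *)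
Definition tilt_parameter m U : R :=
  if mid_density U then m / (density R U ^+ 2 * (1 - density R U ^+ 2)) else 16 / 3 * m.

(** The Chernoff majorant of the event that [U] is a maximiser of energy at least m N while the
    total energy is at most eps N. *)
Definition tilted_weight m eps U w : R :=
  expR (\sum_p tilt U (tilt_parameter m U) p * X p w -
        tilt_parameter m U * (m - density R U ^+ 2 * eps) * NR) *
  (if mid_density U then flip_stable U w else 1).

(** With Q = N m^2 / (2 a^2 (1 - a^2)), the exponent is at most Q - 2 Q + 3 eps N minus the
    stability gain. Nonpositivity of the rate gives Q >= N I(a), and at least N / 10 empty sites
    gain 6 eps N in total. *)
Lemma tilted_weight_dense m eps U : mid_density U ->
    56 / 100 <= m <= 57 / 100 -> 0 < eps -> 60 * eps <= stability_gain R ->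
    (forall x, 0 < x < 1 -> rate m x <= 0) ->
  (\int[P]_w (tilted_weight m eps U w)%:E <=
    (expR (- (NR * entropy (density R U))) * expR (- (3 * eps) * NR))%:E)%E.
Proof.
move=> aU /andP[m1 m2] eps0 epsE rm; rewrite /tilted_weight /tilt_parameter aU.
set a := density R U; have /andP[a1 a2] : 1 / 2 <= a <= 9 / 10 by [].
set lam := m / _.
have va : 0 < a ^+ 2 * (1 - a ^+ 2) by apply: mulr_gt0; nra.
have va2 : 0 < 1 - a ^+ 2 by nra.
have lamE : lam * a ^+ 2 = m / (1 - a ^+ 2).
  by rewrite /lam; field; do ![apply/andP; split]; nra.
(* For a <= 9/10 and m <= 57/100, m / (1 - a^2) is at most 0.57 / 0.19 = 3. *)
have b3 : 0 <= lam * a ^+ 2 <= 3.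
  have h : 1 - 81 / 100 <= 1 - a ^+ 2 by nra.
  rewrite lamE; apply/andP; split; first by rewrite divr_ge0; lra.
  by rewrite ler_pdivrMr//; lra.
have h := integral_expRB (lam * (m - a ^+ 2 * eps) * NR)
  (measurable_tilt_sum U lam) (measurable_flip_stable U) (flip_stable_ge0 U)
  (tilt_stable_mgf indepX sgX (ltnW (ltnW (ltnW (ltnW N5)))) N5 aU b3).
apply: le_trans h _; rewrite lee_fin -expRD ler_expR -/a -/NR.
set g := stability_gain R in epsE *.
have g0 : 0 < g := stability_gain_gt0 R.
have kU : NR / 10 <= #|(~: U)%SET|%:R.
  have kE : #|U|%:R = a * NR by rewrite /a /density divfK// gt_eqF.
  have := cardsC U; rewrite card_ord => /(congr1 (GRing.natmul (1 : R))).
  rewrite natrD kE -/NR => lE.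
  by have : a * NR <= 9 / 10 * NR; [rewrite ler_pM2r|lra].
have gk : g * (NR / 10) <= g * #|(~: U)%SET|%:R by rewrite ler_wpM2l//; lra.
have r0 : entropy a <= m ^+ 2 / (2 * a ^+ 2 * (1 - a ^+ 2)).
  by have := rm a; rewrite /rate subr_le0; apply; lra.
have lam2 : lam ^+ 2 * NR * (a ^+ 2 * (1 - a ^+ 2)) / 2 =
    NR * (m ^+ 2 / (2 * a ^+ 2 * (1 - a ^+ 2))).
  by rewrite /lam; field; do ![apply/andP; split]; nra.
have lamm : lam * (m - a ^+ 2 * eps) * NR =
    2 * (NR * (m ^+ 2 / (2 * a ^+ 2 * (1 - a ^+ 2)))) - lam * a ^+ 2 * (eps * NR).
  by rewrite /lam; field; do ![apply/andP; split]; nra.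
rewrite lam2 lamm.
have r1 : NR * entropy a <= NR * (m ^+ 2 / (2 * a ^+ 2 * (1 - a ^+ 2))) by rewrite ler_pM2l.
have e0 : 0 <= eps * NR by rewrite mulr_ge0// ltW.
have r2 : lam * a ^+ 2 * (eps * NR) <= 3 * (eps * NR).
  by case/andP: b3 => _ b3; rewrite ler_wpM2r.
have r3 : 60 * eps * NR <= g * NR by rewrite ler_pM2r.
move: r1 r2 r3 gk; set A := NR * (m ^+ 2 / _); set B := lam * a ^+ 2 * _.
lra.
Qed.

(** With variance factor 3/16 the exponent per site is -8 m^2 / 3, about -0.84; the error from [eps]
    is at most 0.004. *)
Lemma tilted_weight_sparse m eps U : ~~ mid_density U ->
    56 / 100 + 15 / 100 / 100 <= m <= 57 / 100 -> 0 < eps <= 1 / 1000 ->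
  (\int[P]_w (tilted_weight m eps U w)%:E <= (expR (- (79 / 100) * NR))%:E)%E.
Proof.
move=> aU /andP[m1 m2] /andP[e0 e1]; rewrite /tilted_weight /tilt_parameter (negbTE aU).
set a := density R U; set lam := 16 / 3 * m.
have a0 : 0 <= a by rewrite divr_ge0// ltW.
have a1 : a <= 1.
  by rewrite ler_pdivrMr// mul1r ler_nat -[X in (_ <= X)%N]card_ord max_card.
have va : a ^+ 2 * (1 - a ^+ 2) <= 3 / 16.
  move: aU; rewrite /mid_density -/a negb_and -!ltNge => /orP[h|h].
    have : a ^+ 2 <= 1 / 4 by nra.
    set x := a ^+ 2; nra.
  have : 81 / 100 <= a ^+ 2 by nra.
  have : a ^+ 2 <= 1 by nra.
  set x := a ^+ 2; nra.
have mg := tilt_mgf indepX sgX (ltnW (ltnW (ltnW (ltnW N5)))) U lam.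
have h := @integral_expRB _ (cst 1) (lam * (m - a ^+ 2 * eps) * NR) _
  (measurable_tilt_sum U lam) (measurable_cst _) (fun=> ler01) _.
apply: le_trans (h _ _) _.
  by under eq_integral do rewrite /cst mulr1; exact: mg.
rewrite lee_fin ler_expR -/a -/NR.
have -> : lam ^+ 2 * NR * (a ^+ 2 * (1 - a ^+ 2)) / 2 - lam * (m - a ^+ 2 * eps) * NR =
  (lam ^+ 2 / 2 * (a ^+ 2 * (1 - a ^+ 2)) - lam * m + lam * eps * a ^+ 2) * NR by field.
rewrite ler_pM2r//.
have l2 : 0 <= lam ^+ 2 / 2 by rewrite divr_ge0// sqr_ge0.
have h1 := ler_wpM2l l2 va.
have lame : 0 <= lam * eps <= 4 / 1000 by rewrite /lam; apply/andP; split; nra.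
have a2 : a ^+ 2 <= 1 by nra.
have h2 : lam * eps * a ^+ 2 <= 4 / 1000 by nra.
have m22 : (56 / 100 + 15 / 100 / 100) ^+ 2 <= m ^+ 2 by rewrite lerXn2r// nnegrE; lra.
have lE : lam ^+ 2 / 2 * (3 / 16) - lam * m = - (8 / 3) * m ^+ 2 by rewrite /lam; field.
lra.
Qed.

End UnionBound.

(** * The probability that some configuration reaches the threshold *)

Section GroundState.
Context d (T : measurableType d) (R : realType) (P : probability T R).
Context (N : nat) (X : 'I_N * 'I_N -> {RV P >-> R}).
Hypothesis indepX : mutually_independent X.
Hypothesis sgX : forall p, subgaussian_with_variance P (X p) 1.
Hypothesis N5 : (5 <= N)%N.
Implicit Types (U : {set 'I_N}) (m eps : R) (w : T).

Let NR : R := N%:R.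
Let NR0 : 0 < NR. Proof. by rewrite ltr0n (leq_trans _ N5). Qed.
Let t : R := (Num.sqrt NR)^-1.
Let t0 : 0 < t. Proof. by rewrite invr_gt0 sqrtr_gt0. Qed.
Let t2 : t ^+ 2 = NR^-1. Proof. by rewrite exprVn sqr_sqrtr// ltW. Qed.

Lemma tilted_weight_ge0 m eps U w : 0 <= tilted_weight X m eps U w.
Proof.
by rewrite /tilted_weight mulr_ge0 ?expR_ge0//; case: ifP => // _; exact: flip_stable_ge0.
Qed.

Lemma measurable_tilted_weight m eps U :
  measurable_fun setT (tilted_weight X m eps U).
Proof.
apply: measurable_funM; last first.
  by case: (mid_density R U); [exact: measurable_flip_stable|exact: measurable_cst].
apply: measurableT_comp; first exact: measurable_expR.
by apply: measurable_funB => //; exact: measurable_tilt_sum.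
Qed.

(* Take a maximiser [U] of the energy: flipping a site [i] out of it does not
   increase the energy, i.e. the increment over [flip_block U i] is nonpositive. *)
Lemma ground_state_cover m eps w : 0 < m -> 0 < eps ->
  (exists U, m * NR <= set_energy X U w) ->
  1 <= expR (eps * total_energy X w - eps ^+ 2 * NR) + \sum_U tilted_weight X m eps U w.
Proof.
move=> m0 e0 [U0 mU0].
have S0 : 0 <= \sum_U tilted_weight X m eps U w.
  by apply: sumr_ge0 => U _; exact: tilted_weight_ge0.
(* A large total energy is covered by the first exponential alone; otherwise the weight of a
   maximiser is at least 1. *)
have [Sw|Sw] := leP (eps * NR) (total_energy X w).
  have : 1 <= expR (eps * total_energy X w - eps ^+ 2 * NR).
    by rewrite -[leLHS]expR0 ler_expR subr_ge0 expr2 -mulrA ler_pM2l.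
  lra.
have [U _ Umax] := @arg_maxP _ R _ U0 xpredT (fun U => set_energy X U w) isT.
have mU : m * NR <= set_energy X U w by apply: le_trans mU0 _; exact: Umax.
have stable : flip_stable X U w = 1.
  apply: big1 => i _; rewrite (_ : _ <= 0)//.
  have := Umax (i |: U)%SET isT.
  by rewrite /set_energy sum_squareU /= ler_pM2l// gerDl.
suff : 1 <= tilted_weight X m eps U w.
  move=> h; rewrite (bigD1 U)//= addrCA -[leLHS]addr0 lerD// addr_ge0 ?expR_ge0//.
  by apply: sumr_ge0 => V _; exact: tilted_weight_ge0.
rewrite /tilted_weight stable if_same mulr1 -[leLHS]expR0 ler_expR subr_ge0.
have lam0 : 0 <= tilt_parameter m U.
  rewrite /tilt_parameter; case: ifP => [/andP[a1 a2]|_]; last by lra.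
  by rewrite divr_ge0//; [lra|apply: mulr_ge0; nra].
rewrite tilt_sumE -mulrA ler_wpM2l//.
have h := ler_wpM2l (sqr_ge0 (density R U)) (ltW Sw).
move: mU h; rewrite -/NR; lra.
Qed.

(** The total energy has variance N, so the exponent is eps^2 N / 2 - eps^2 N. *)
Lemma total_energy_mgf eps :
  (\int[P]_w (expR (eps * total_energy X w - eps ^+ 2 * NR))%:E <=
   (expR (- (eps ^+ 2 / 2 * NR)))%:E)%E.
Proof.
have h := @integral_expRB _ _ _ P (fun w => eps * total_energy X w) (cst 1)
  (eps ^+ 2 * NR) (eps ^+ 2 * NR / 2).
under eq_integral => w _ do rewrite -[expR _]mulr1.
apply: le_trans (h _ _ _ _) _ => //.
- by apply: measurable_funM => //; exact: measurable_total_energy.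
- under eq_integral => w _.
    rewrite /cst mulr1 /total_energy mulrA mulr_sumr.
    over.
  have := subgaussian_mgf_sum indepX sgX finset.setT (fun=> eps * t).
  rewrite sumr_const cardsT card_prod card_ord -[_ *+ _]mulr_natr natrM exprMn t2.
  have -> : eps ^+ 2 * NR^-1 * (N%:R * N%:R) = eps ^+ 2 * NR.
    by rewrite -/NR; field; rewrite gt_eqF.
  apply: le_trans; rewrite le_eqVlt; apply/orP; left; apply/eqP.
  by apply: eq_integral => w _; congr (expR _)%:E; apply: eq_bigl => p; rewrite inE.
- by rewrite lee_fin ler_expR; lra.
Qed.

(** The expectation of the cover, with intermediate densities grouped by cardinality. The factor N +
    3 collects the total energy, at most N + 1 cardinalities, and all sparse or very dense sets
    together. *)
Lemma ground_state_bound m eps :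
    56 / 100 + 15 / 100 / 100 <= m <= 57 / 100 ->
    0 < eps -> 60 * eps <= stability_gain R ->
    (forall x, 0 < x < 1 -> rate m x <= 0) ->
  (P [set w | exists U, (m * NR <= set_energy X U w)%R] <=
   ((NR + 3) * expR (- (eps ^+ 2 / 2 * NR)))%:E)%E.
Proof.
move=> /andP[m1 m2] e0 e1 rm; set A := [set w | _].
have g1 := stability_gain_le R.
have mA : measurable A.
  rewrite (_ : A = \bigcup_(U in [set: {set 'I_N}]) [set w | m * NR <= set_energy X U w]).
    apply: fin_bigcup_measurable; first exact: finite_finset.
    move=> U _; rewrite -[X in measurable X]setTI.
    by apply: measurable_fun_le => //; exact: measurable_set_energy.
  by apply/seteqP; split => w /= [U]; [exists U|exists U].
have mW U : measurable_fun setT (fun w => (tilted_weight X m eps U w)%:E).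
  by apply/measurable_EFinP; exact: measurable_tilted_weight.
have W0 U w : (0 <= (tilted_weight X m eps U w)%:E)%E.
  by rewrite lee_fin; exact: tilted_weight_ge0.
have mS : measurable_fun setT (fun w => (expR (eps * total_energy X w - eps ^+ 2 * NR))%:E).
  apply/measurable_EFinP; apply: measurableT_comp; first exact: measurable_expR.
  apply: measurable_funB => //; apply: measurable_funM => //.
  exact: measurable_total_energy.
have le1 : (P A <= \int[P]_w (expR (eps * total_energy X w - eps ^+ 2 * NR))%:E +
    \sum_U \int[P]_w (tilted_weight X m eps U w)%:E)%E.
  rewrite -(setIT A) -integral_indic//.
  rewrite -ge0_integral_sum// -ge0_integralD//; last 2 first.
  - by move=> w _; exact: sume_ge0.
  - exact: emeasurable_sum.
  apply: ge0_le_integral => //.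
  - by apply/measurable_EFinP; exact: measurable_indic.
  - by apply: emeasurable_funD => //; exact: emeasurable_sum.
  move=> w _; rewrite sumEFin -EFinD lee_fin indicE.
  case: (boolP (w \in A)) => [|_].
    by rewrite inE => /ground_state_cover; apply; lra.
  rewrite addr_ge0 ?expR_ge0//; apply: sumr_ge0 => U _; exact: tilted_weight_ge0.
apply: le_trans le1 _.
pose q (k : nat) : R := if 1 / 2 <= k%:R / NR <= 9 / 10 then
  expR (- (NR * entropy (k%:R / NR))) * expR (- (3 * eps) * NR)
  else expR (- (79 / 100) * NR).
have qU U : (\int[P]_w (tilted_weight X m eps U w)%:E <= (q #|U|)%:E)%E.
  rewrite /q; case: ifPn => aU.
    by apply: tilted_weight_dense => //; lra.
  by apply: tilted_weight_sparse => //; lra.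
apply: (@le_trans _ _ (expR (- (eps ^+ 2 / 2 * NR)) + \sum_(U : {set 'I_N}) q #|U|)%:E).
  rewrite EFinD -sumEFin.
  by apply: leeD; [exact: total_energy_mgf|exact: lee_sum].
rewrite lee_fin.
have e2 : eps <= 1 by lra.
have ee : eps ^+ 2 <= eps by rewrite expr2 ler_piMl// ltW.
have qs : \sum_(U : {set 'I_N}) q #|U| <=
    (NR + 1) * expR (- (3 * eps) * NR) + expR (- (4 / 100) * NR).
  (* The crude bound is charged to every subset, so only the entropy term has to be sorted by
     cardinality. *)
  apply: (@le_trans _ _ (\sum_(U : {set 'I_N}) ((if 1 / 2 <= #|U|%:R / NR <= 9 / 10 then
    expR (- (NR * entropy (#|U|%:R / NR))) else 0) * expR (- (3 * eps) * NR)
    + expR (- (79 / 100) * NR)))).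
    apply: ler_sum => U _; rewrite /q; case: ifP => _; last by rewrite mul0r add0r.
    by rewrite lerDl expR_ge0.
  rewrite big_split/= lerD ?sum_sets_expR// -mulr_suml ler_pM2r ?expR_gt0//.
  rewrite (sum_over_card N (fun k => if 1 / 2 <= k%:R / NR <= 9 / 10 then
    expR (- (NR * entropy (k%:R / NR))) else 0)).
  rewrite (_ : NR + 1 = \sum_(k < N.+1) 1); last first.
    by rewrite sumr_const card_ord -natr1.
  apply: ler_sum => k _; case: ifP => [/andP[k1 k2]|_]; last by rewrite mulr0.
  (* The density bounds exclude k = 0 and k = N. *)
  apply: bin_entropy_le1; apply/andP; split.
    rewrite lt0n; apply: contraTneq k1 => ->; rewrite mul0r -ltNge; lra.
  rewrite -(ltr_nat R) -/NR; move: k2; rewrite ler_pdivrMr//; have := NR0; rewrite /NR; lra.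
apply: le_trans (lerD (lexx _) qs) _.
set D := expR (- (eps ^+ 2 / 2 * NR)).
have h1 : expR (- (3 * eps) * NR) <= D.
  by rewrite ler_expR mulNr lerN2 ler_pM2r//; lra.
have h2 : expR (- (4 / 100) * NR) <= D.
  by rewrite ler_expR mulNr lerN2 ler_pM2r//; lra.
have h3 : (NR + 1) * expR (- (3 * eps) * NR) <= (NR + 1) * D.
  by rewrite ler_pM2l// addr_gt0.
lra.
Qed.

End GroundState.

(** * From occupation vectors to sets, and the final estimate *)

Section Occupation.
Context {R : realType} (N : nat).
Implicit Types (J : 'I_N -> 'I_N -> R) (m : R).

Lemma hamiltonian_square J (eta : {ffun 'I_N -> bool}) :
  hamiltonian J eta =
  (Num.sqrt N%:R)^-1 * \sum_(p in square [set i | eta i]%SET) J p.1 p.2.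
Proof.
rewrite /hamiltonian pair_bigA/= [in RHS]big_mkcond; congr (_ * _).
apply: eq_bigr => -[i j] _; rewrite in_square !inE/=.
by case: (eta i) => /=; case: (eta j) => /=; rewrite ?mulr0 ?mul0r ?mulr1.
Qed.

Lemma nu_plus_gt0 J m : (0 < nu_plus J m)%N <-> exists U : {set 'I_N},
  m * N%:R <= (Num.sqrt N%:R)^-1 * \sum_(p in square U) J p.1 p.2.
Proof.
split.
  case/card_gt0P => eta; rewrite inE hamiltonian_square => h.
  by exists [set i | eta i]%SET.
case=> U h; apply/card_gt0P; exists [ffun i => i \in U].
rewrite inE hamiltonian_square (_ : [set i | _]%SET = U)//.
by apply/finset.setP => i; rewrite inE ffunE.
Qed.

(** Negating all entries exchanges the two counts. *)
Lemma nu_minus_gt0 J m : (0 < nu_minus J m)%N <-> exists U : {set 'I_N},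
  m * N%:R <= (Num.sqrt N%:R)^-1 * \sum_(p in square U) - J p.1 p.2.
Proof.
rewrite (_ : nu_minus J m = nu_plus (fun i j => - J i j) m); first exact: nu_plus_gt0.
apply: eq_card => eta; rewrite !inE !hamiltonian_square.
by rewrite sumrN mulrN lerNr.
Qed.

End Occupation.

Lemma mutually_independentN d (T : measurableType d) (R : realType)
    (P : probability T R) (I : finType) (X : I -> {mfun T >-> R}) :
  @mutually_independent _ _ _ P I X ->
  @mutually_independent _ _ _ P I (fun i => - X i).
Proof.
move=> indepX S A mA.
have E i : (- X i)%R @^-1` A i = X i @^-1` (-%R @^-1` A i) by [].
rewrite (eq_bigcapr (fun i _ => E i)) indepX; last first.
  by move=> i; rewrite -[X in measurable X]setTI; exact: oppr_measurable.
by apply: eq_bigr => i _; rewrite E.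
Qed.

(** Half of the decay pays for the linear factor: with y = k x / 2, e^y >= 1 + y^2 / 2 >= 1 + 4 x >=
    x + 3. *)
Lemma expR_absorb_linear (R : realType) (k x : R) : 0 < k -> 1 <= x -> 32 / k ^+ 2 <= x ->
  (x + 3) * expR (- (k * x)) <= expR (- (k / 2 * x)).
Proof.
move=> k0 x1; rewrite ler_pdivrMr ?exprn_gt0// => kx.
have y0 : 0 <= k / 2 * x by apply: mulr_ge0; lra.
have h : x + 3 <= expR (k / 2 * x).
  apply: le_trans (expR_ge1Dxn 1 y0).
  have -> : 1 + (k / 2 * x) ^+ 2 / 2`!%:R = 1 + x * k ^+ 2 * x / 8.
    by rewrite (_ : 2`! = 2)//; field.
  have : 32 * x <= x * k ^+ 2 * x by rewrite ler_pM2r//; lra.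
  lra.
have -> : - (k / 2 * x) = k / 2 * x + - (k * x) by field.
by rewrite expRD ler_pM2r// expR_gt0.
Qed.

Theorem corollary2p4 (R : realType)
    (d : nat -> measure_display) (T : forall N : nat, measurableType (d N))
    (P : forall N : nat, probability (T N) R)
    (J : forall N : nat, 'I_N -> 'I_N -> {RV (P N) >-> R})
    (J_indep : forall N : nat,
      mutually_independent (fun ij : 'I_N * 'I_N => J N ij.1 ij.2))
    (J_law : forall (N M : nat) (i j : 'I_N) (k l : 'I_M),
      same_law (J N i j) (J M k l))
    (J_ssg : forall (N : nat) (i j : 'I_N), strictly_subgaussian (J N i j)) :
  [/\ `|m_star R - 562%:R / 1000%:R| <= 1 / 2000%:R,
      exists alpha_star : R,
        [/\ 0 < alpha_star < 1, rate (m_star R) alpha_star = 0 &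
            `|alpha_star - 644%:R / 1000%:R| <= 1 / 2000%:R] &
      exists2 C : R, 0 < C &
        \forall N \near \oo,
          (P N [set w | (0 < nu_minus (fun i j => J N i j w) (m_star R))%N]
             <= (expR (- (C * N%:R)))%:E)%E /\
          (P N [set w | (0 < nu_plus (fun i j => J N i j w) (m_star R))%N]
             <= (expR (- (C * N%:R)))%:E)%E].
Proof.
have [c [/andP[c1 c2] rc rate_le0 /andP[m1 m2]]] := @m_starP R.
rewrite /alpha_lo in c1; rewrite /alpha_hi in c2.
split.
- rewrite ler_norml; apply/andP; split; lra.
- exists c; split=> //; first lra.
  rewrite ler_norml; apply/andP; split; lra.
have g0 := stability_gain_gt0 R.
(* Sixty is ten, for the fraction of empty sites, times six: three to offset the error from [eps]
   and three left as decay. *)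
pose eps : R := stability_gain R / 60.
have eps0 : 0 < eps by rewrite /eps; lra.
have epsE : 60 * eps <= stability_gain R by rewrite /eps; lra.
pose k := eps ^+ 2 / 2.
have k0 : 0 < k by rewrite divr_gt0// exprn_gt0.
exists (k / 2); first by rewrite divr_gt0.
near=> N.
have N5 : (5 <= N)%N by near: N; exact: nbhs_infty_ge.
have Nk : 32 / k ^+ 2 <= N%:R by near: N; exact: nbhs_infty_ger.
have N1 : 1 <= N%:R :> R by rewrite ler1n (leq_trans _ N5).
have mm : 56 / 100 + 15 / 100 / 100 <= m_star R <= 57 / 100 by apply/andP; split; lra.
have bound (X : 'I_N * 'I_N -> {RV (P N) >-> R}) : mutually_independent X ->
    (forall p, subgaussian_with_variance (P N) (X p) 1) ->
    (P N [set w | exists U : {set 'I_N}, (m_star R * N%:R <= set_energy X U w)%R] <=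
     (expR (- (k / 2 * N%:R)))%:E)%E.
  move=> indepX sgX.
  apply: le_trans (ground_state_bound indepX sgX N5 mm eps0 epsE rate_le0) _.
  by rewrite lee_fin; exact: expR_absorb_linear.
have sgJ p := strictly_subgaussian_variance1 (J_ssg N p.1 p.2).
split.
(* The lower tail is the upper tail of the negated entries, which satisfy the same hypotheses. *)
- have := bound _ (mutually_independentN (J_indep N)) (fun p => subgaussian_opp (sgJ p)).
  apply: le_trans; rewrite le_eqVlt; apply/orP; left; apply/eqP; congr (P N _).
  by apply/seteqP; split => w /=;
    [move/(nu_minus_gt0 (fun i j => J N i j w))|
     move=> h; apply/(nu_minus_gt0 (fun i j => J N i j w))].
- apply: le_trans (bound _ (J_indep N) sgJ).
  rewrite le_eqVlt; apply/orP; left; apply/eqP; congr (P N _).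
  by apply/seteqP; split => w /=;
    [move/(nu_plus_gt0 (fun i j => J N i j w))|
     move=> h; apply/(nu_plus_gt0 (fun i j => J N i j w))].
Unshelve. all: by end_near. Qed.
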